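(* Assume that $\Lambda_Y(\theta)=\log\mathbb E_{\mathfrak a}[\exp\{\theta\cdot Y_1\}]<\infty$ for every $\theta\in\mathbb R^d$, and let $I_Y(y)=\sup_{\theta\in\mathbb R^d}\{\theta\cdot y-\Lambda_Y(\theta)\}$, $y\in\mathbb R^d$. Let $\lambda\in\Delta_d$, let $k_t\in\mathbb N^d$ ($t>0$) satisfy $|k_t-t\lambda|_1=o(t)$ as $t\to\infty$, and let $r>0$. If $r>\kappa(\lambda)$, then $$-r\inf_{y\in B^<(\lambda/r)}I_Y(y)\le\liminf_{t\to\infty}\frac1t\log\mathbb P_{\mathfrak a}(\mathfrak N(k_t)\ge rt)$$ and $$\limsup_{t\to\infty}\frac1t\log\mathbb P_{\mathfrak a}(\mathfrak N(k_t)\ge rt)\le-r\inf_{y\in B^\le(\lambda/r)}I_Y(y).$$ If $0<r<\kappa(\lambda)$, then $$-r\inf_{y\notin B^\le(\lambda/r)}I_Y(y)\le\liminf_{t\to\infty}\frac1t\log\mathbb P_{\mathfrak a}(\mathfrak N(k_t)<rt)$$ and $$\limsup_{t\to\infty}\frac1t\log\mathbb P_{\mathfrak a}(\mathfrak N(k_t)<rt)\le-r\inf_{y\notin B^<(\lambda/r)}I_Y(y).$$ In particular, whenever the two infima in the corresponding upper and lower bounds coincide, the logarithmic limit exists.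
   Context: Notation: $\mathbb N=\{0,1,2,\dots\}$, $d\ge1$; $r\leq_d k$ means $r_j\le k_j$ for all $j$; $0_d$ is the zero vector; $|k|_1=\sum_j|k_j|$. For $a\in\mathbb R^d$: $B^<(a)=\{y\in\mathbb R^d:y_r<a_r,\ 1\le r\le d\}$, $B^\le(a)=\{y\in\mathbb R^d:y_r\le a_r,\ 1\le r\le d\}$. The infimum over the empty set is $+\infty$. Markov renewal chain. $(\mathsf X,\mathcal X)$ is a standard Borel space and $q=(q_k)_{k\in\mathbb N^d}$ is a family of non-negative kernels on $\mathsf X$ with $\sum_{k}q_k(x,\mathsf X)=1$ for all $x$, assumed strict: $q_{0_d}=0$. The chain $(J_n,S_n)_{n\ge0}$ in $\mathsf X\times\mathbb N^d$ has $S_0=0_d$ and, with $X_{n+1}=S_{n+1}-S_n$, $\mathbb P(J_{n+1}\in A,X_{n+1}=k\mid J_0,S_0,\dots,J_n,S_n)=q_k(J_n,A)$. Put $P(x,A)=\sum_kq_k(x,A)$ and $Q(x,A\times B)=\sum_{k\in B}q_k(x,A)$. Standing assumptions. (i) $P$ is positive Harris recurrent with invariant probability $\pi$, and $0<\mu_r=\int_{\mathsf X}\sum_kk_rq_k(x,\mathsf X)\,\pi(dx)<\infty$ for $r=1,\dots,d$. (ii) There are $C\in\mathcal X$ with $\pi(C)>0$, $\varepsilon\in(0,1]$ and a probability measure $\vartheta$ on $\mathsf X\times\mathbb N^d$ with $Q(x,\cdot)\ge\varepsilon\vartheta(\cdot)$ for $x\in C$. Split chain. $\widehat J_n=(J_n,\chi_n)$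 lives in $\widehat{\mathsf X}=(\mathsf X\times\{0\})\cup(C\times\{1\})$. Given $\widehat J_n=(x,1)$, $(J_{n+1},X_{n+1})$ has law $\vartheta$; given $(x,0)$ with $x\in C$ it has law $(Q(x,\cdot)-\varepsilon\vartheta)/(1-\varepsilon)$ (not used when $\varepsilon=1$); given $(x,0)$ with $x\notin C$ it has law $Q(x,\cdot)$. Then, given $J_{n+1}=y$, independently of the past, $\chi_{n+1}=1$ with probability $\varepsilon$ and $0$ otherwise if $y\in C$, and $\chi_{n+1}=0$ if $y\notin C$. The set $\mathfrak a=C\times\{1\}$ is an atom. $\mathbb P_{\mathfrak a}$ is the law of the split chain started from the normalized restriction to $\mathfrak a$ of its invariant probability (so $J_0\sim\pi(\cdot\cap C)/\pi(C)$, $\chi_0=1$, $S_0=0_d$). Cycles. $T_0=0$, $T_{j+1}=\inf\{n>T_j:\widehat J_n\in\mathfrak a\}$; $Y_j=S_{T_j}-S_{T_{j-1}}$, $j\ge1$; $C_n=Y_1+\cdots+Y_n$ ($C_0=0_d$); $\mathfrak N(k)=\sup\{n\ge0:C_n\leq_dk\}$; $m=\mathbb E_{\mathfrak a}[Y_1]\in(0,\infty)^d$. Directions. $\Delta_d=\{\lambda\in(0,1)^d:\lambda_1+\cdots+\lambda_d=1\}$, $\kappa(\lambda)=\min_{1\le r\le d}\lambda_r/m_r$. *)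

(* Defs.v *)
From HB Require Import structures.
From mathcomp Require Import all_boot all_order all_algebra.
From mathcomp Require Import all_classical all_reals all_analysis.

Set Implicit Arguments.
Unset Strict Implicit.
Unset Printing Implicit Defensive.

Import Order.TTheory GRing.Theory Num.Theory.
Import numFieldNormedType.Exports.

Local Open Scope classical_set_scope.
Local Open Scope ring_scope.
Local Open Scope ereal_scope.

(* N^d is 'rV[nat]_d, with every subset measurable. *)
HB.instance Definition _ (d : nat) := @isMeasurable.Build default_measure_display
  'rV[nat]_d (@discrete_measurable 'rV[nat]_d) (@discrete_measurable0 _)
  (@discrete_measurableC _) (@discrete_measurableU _).

Definition le_vec d (a b : 'rV[nat]_d) : Prop := forall i, (a 0%R i <= b 0%R i)%N.

(* Componentwise truncated subtraction, only applied to a, b with b <= a. *)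
Definition sub_vec d (a b : 'rV[nat]_d) : 'rV[nat]_d :=
  \row_i (a 0%R i - b 0%R i)%N.

Definition real_vec (R : realType) d (a : 'rV[nat]_d) : 'rV[R]_d :=
  map_mx (fun n : nat => n%:R%R) a.
Arguments real_vec R {d} a.

Definition dotr (R : realType) d (a b : 'rV[R]_d) : R :=
  (\sum_(i < d) a 0 i * b 0 i)%R.

Definition norm1 (R : realType) d (a : 'rV[R]_d) : R :=
  (\sum_(i < d) `|a 0 i|)%R.

(* X carries the Borel sigma-algebra of a Polish space: up to a bijection, of
   a complete separable metric space. *)
Definition standard_borel (R : realType) disp (X : measurableType disp) : Prop :=
  exists (M : metricType R) (f : X -> M),
    [/\ bijective f,
        (forall F : set_system M, ProperFilter F -> cauchy F -> exists y : M, F --> y),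
        (exists2 D : set M, countable D & dense D) &
        @measurable _ X = <<s preimage_set_system setT f open >>].

Section conditional_laws.
Context (R : realType) (dO : measure_display) (Om : measurableType dO).

(* The sigma-algebra generated by Z 0, ..., Z n. *)
Definition history dE (E : measurableType dE) (Z : nat -> Om -> E) (n : nat) :
    set_system Om :=
  <<s \bigcup_(i in [set i | (i <= n)%N])
        preimage_set_system setT (Z i) measurable >>.

(* K is the conditional law of U given the sigma-algebra G.  In the uses below
   w |-> K w B is G-measurable. *)
Definition cond_law dE (E : measurableType dE) (Pr : probability Om R)
    (G : set_system Om) (U : Om -> E) (K : Om -> set E -> \bar R) : Prop :=
  forall (H : set Om) (B : set E), G H -> measurable B ->
    Pr (H `&` U @^-1` B) = \int[Pr]_(w in H) K w B.

Definition markov_chain dX (X : measurableType dX) (P : X -> set X -> \bar R)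
    (Pr : probability Om R) (J : nat -> Om -> X) : Prop :=
  (forall n, measurable_fun setT (J n)) /\
  (forall n, cond_law Pr (history J n) (J n.+1) (fun w => P (J n w))).

End conditional_laws.

(* The quantification over all realizations of the chain started at x expresses
   a statement about its law P_x. *)
Definition harris_recurrent (R : realType) dX (X : measurableType dX)
    (P : X -> set X -> \bar R) : Prop :=
  exists phi : {measure set X -> \bar R},
    [/\ sigma_finite setT phi, 0 < phi setT &
      forall A, measurable A -> 0 < phi A ->
      forall (x : X) dO (Om : measurableType dO) (Pr : probability Om R)
        (J : nat -> Om -> X),
        markov_chain P Pr J -> (forall w, J 0%N w = x) ->
        Pr (lim_sup_set (fun n => J n @^-1` A)) = 1].

Definition positive_harris (R : realType) dX (X : measurableType dX)
    (P : X -> set X -> \bar R) (pi : probability X R) : Prop :=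
  harris_recurrent P /\
  forall A, measurable A -> \int[pi]_x P x A = pi A.

Section markov_renewal.
Context (R : realType) (dX : measure_display) (X : measurableType dX) (d : nat).
Variable q : 'rV[nat]_d -> R.-ker X ~> X.

Definition renewal_kernel : Prop :=
  (forall x, \esum_(k in [set: 'rV[nat]_d]) q k x setT = 1) /\
  (forall x A, measurable A -> q 0%R x A = 0).

Definition kerP (x : X) (A : set X) : \bar R :=
  \esum_(k in [set: 'rV[nat]_d]) q k x A.

(* On rectangles: kerQ x (A `*` B) is the sum of q k x A over k in B. *)
Definition kerQ (x : X) (E : set (X * 'rV[nat]_d)) : \bar R :=
  \esum_(k in [set: 'rV[nat]_d]) q k x [set y | E (y, k)].

Definition mean_drift (pi : probability X R) (i : 'I_d) : \bar R :=
  \int[pi]_x \esum_(k in [set: 'rV[nat]_d]) ((k 0%R i)%:R%:E * q k x setT).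

Definition minorization (C : set X) (eps : R)
    (vtheta : probability (X * 'rV[nat]_d)%type R) : Prop :=
  forall x, C x -> forall E, measurable E -> eps%:E * vtheta E <= kerQ x E.

(* Law of (J_{n+1}, X_{n+1}) given (J_n, chi_n) = (x, b).  When eps = 1 the
   middle case is the junk value 0; its condition then has probability 0. *)
Definition split_kernel (C : set X) (eps : R)
    (vtheta : probability (X * 'rV[nat]_d)%type R)
    (z : X * bool) (E : set (X * 'rV[nat]_d)) : \bar R :=
  if z.2 then vtheta E
  else if z.1 \in C then ((1 - eps)^-1)%:E * (kerQ z.1 E - eps%:E * vtheta E)
  else kerQ z.1 E.

End markov_renewal.

Section split_chain.
Context (R : realType) (dX : measure_display) (X : measurableType dX) (d : nat).
Context (dO : measure_display) (Om : measurableType dO).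

(* V n.+1 is the increment X_{n+1}; V 0 is not used. *)
Definition walk (V : nat -> Om -> 'rV[nat]_d) (n : nat) (w : Om) : 'rV[nat]_d :=
  (\sum_(i < n) V i.+1 w)%R.

(* Under Pr, the process (J, chi, walk V) is the split chain with law P_a. *)
Record split_chain_from_atom (q : 'rV[nat]_d -> R.-ker X ~> X)
    (pi : probability X R) (C : set X) (eps : R)
    (vtheta : probability (X * 'rV[nat]_d)%type R)
    (Pr : probability Om R) (J : nat -> Om -> X) (chi : nat -> Om -> bool)
    (V : nat -> Om -> 'rV[nat]_d) : Prop := SplitChainFromAtom {
  split_measurable : forall n, [/\ measurable_fun setT (J n),
    measurable_fun setT (chi n) & measurable_fun setT (V n)] ;
  split_space : forall n w, chi n w -> C (J n w) ;
  split_init : forall A, measurable A ->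
    Pr [set w | A (J 0%N w) /\ chi 0%N w] = pi (A `&` C) / pi C ;
  split_step : forall n,
    cond_law Pr (history (fun i w => (J i w, chi i w, walk V i w)) n)
      (fun w => (J n.+1 w, V n.+1 w))
      (fun w => split_kernel q C eps vtheta (J n w, chi n w)) ;
  (* chi_{n+1} is drawn given J_{n+1}, independently of the past, which
     includes the increment X_{n+1}. *)
  split_mark : forall n,
    cond_law Pr
      <<s history (fun i w => (J i w, chi i w, walk V i w)) n `|`
          preimage_set_system setT (fun w => (J n.+1 w, V n.+1 w)) measurable >>
      (chi n.+1) (fun w => bernoulli_prob (eps * \1_C (J n.+1 w))%R)
}.

End split_chain.

(* Infimum in N u {+oo}; None stands for +oo, the infimum of the empty set. *)
Definition nat_inf (A : set nat) : option nat :=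
  match pselect (exists n, `[< A n >]) with
  | left h => Some (ex_minn h)
  | right _ => None
  end.

Fixpoint visit_time (A : set nat) (j : nat) : option nat :=
  if j is j'.+1 then
    if visit_time A j' is Some n then nat_inf [set m | (n < m)%N /\ A m]
    else None
  else Some 0%N.

Section cycles.
Context (R : realType) (dX : measure_display) (X : measurableType dX) (d : nat).
Context (dO : measure_display) (Om : measurableType dO).
Variables (C : set X) (J : nat -> Om -> X) (chi : nat -> Om -> bool)
  (V : nat -> Om -> 'rV[nat]_d).

Definition atom_time (j : nat) (w : Om) : option nat :=
  visit_time [set n | C (J n w) /\ chi n w] j.

(* cycle j is Y_j for j >= 1; the junk value 0 is used on the null event where
   T_j is infinite. *)
Definition cycle (j : nat) (w : Om) : 'rV[nat]_d :=
  match atom_time j.-1 w, atom_time j w with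
  | Some m, Some n => sub_vec (walk V n w) (walk V m w)
  | _, _ => 0%R
  end.

Definition cycle_sum (n : nat) (w : Om) : 'rV[nat]_d :=
  (\sum_(1 <= j < n.+1) cycle j w)%R.

Definition cycle_count (k : 'rV[nat]_d) (w : Om) : \bar R :=
  ereal_sup [set n%:R%:E | n in [set n | le_vec (cycle_sum n w) k]].

Variable Pr : probability Om R.

Definition mean_cycle (i : 'I_d) : \bar R :=
  'E_Pr[fun w => (cycle 1%N w 0 i)%:R%R].

Definition kappa (lam : 'rV[R]_d) : R :=
  inf (range (fun i : 'I_d => lam 0 i / fine (mean_cycle i)))%R.

Definition Lambda_Y (theta : 'rV[R]_d) : \bar R :=
  lne 'E_Pr[fun w => expR (dotr theta (real_vec R (cycle 1%N w)))].

Definition I_Y (y : 'rV[R]_d) : \bar R :=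
  ereal_sup (range (fun theta => (dotr theta y)%:E - Lambda_Y theta)).

Definition log_rate (E : R -> set Om) (t : R) : \bar R :=
  (t^-1)%:E * lne (Pr (E t)).

End cycles.

Arguments cycle_count R {dX X d dO Om} C J chi V k w.

Definition simplex_dir (R : realType) d (lam : 'rV[R]_d) : Prop :=
  (forall i, 0 < lam 0 i < 1)%R /\ (\sum_(i < d) lam 0 i = 1)%R.

Definition B_lt (R : realType) d (a : 'rV[R]_d) : set 'rV[R]_d :=
  [set y | forall i, (y 0 i < a 0 i)%R].

Definition B_le (R : realType) d (a : 'rV[R]_d) : set 'rV[R]_d :=
  [set y | forall i, (y 0 i <= a 0 i)%R].

(* Main.v *)
(** Regeneration at the atom makes the cycles Y_1, Y_2, ... independent with a
    common law, so E exp(theta . C_n) = M(theta)^n with M = exp Lambda_Y.  This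
    product formula is all that the large deviation part uses.  The atom is
    recurrent because the split chain has an invariant probability charging it:
    mass that leaves the atom and has not returned yet adds up, over all elapsed
    times, to a measure dominated by that probability, hence the probability of
    not having returned after l steps is summable in l.

    Since {N(k) >= s} = {C_n <= k} for n = ceil(s), the claims are Cramer bounds
    for C_n.  Upper bound: half-space Chernoff bounds and a finite cover of a
    large cube.  Lower bound at y with I_Y(y) finite: the function
    Lambda_Y(theta) - theta . y + (e/2) |theta|^2 is coercive, because
    Lambda_Y(theta) - theta . y >= - I_Y(y); its minimizer theta_e satisfies
    grad Lambda_Y(theta_e) = y - e theta_e, a point that tends to y and where
    I_Y is at most I_Y(y); the tilt by theta_e then concentrates C_n / n there. *)

Require Import Defs.
From HB Require Import structures.
From mathcomp Require Import all_boot all_order all_algebra.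
From mathcomp Require Import all_classical all_reals all_analysis.
From mathcomp Require Import measurable_realfun lra ring.

Set Implicit Arguments.
Unset Strict Implicit.
Unset Printing Implicit Defensive.

Import Order.TTheory GRing.Theory Num.Theory.
Import numFieldNormedType.Exports.

Local Open Scope classical_set_scope.
Local Open Scope ring_scope.
Local Open Scope ereal_scope.

(** * Measure-theoretic preliminaries *)

(** The conditional laws speak of fixed times only, whereas cycles start at the random times T_j. As
    times and positions in N^d are countable, regeneration at T_j is reduced to regeneration at a
    fixed time [m] on the event T_j = m; only the state [J] needs an integral, and equality of its
    laws is carried from step to step. On the large deviation side the obstacle is that the supremum
    in I_Y(y) need not be attained, for instance at the boundary of the convex hull of the support
    of Y_1; the quadratic penalty restores a minimizer. Neither a gradient nor a tilted probability
    is constructed: a one-sided second-order upper bound for M along the coordinate axes yields both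
    the stationarity of the minimizer and the exponential smallness of the tilted tails, and the
    change of measure becomes a pointwise inequality between exponentials that is integrated once.
    Coordinate directions suffice because the neighbourhoods in the lower bound are boxes. *)

Lemma esum_pickle (R : realType) (T : countType) (f : T -> \bar R) : (forall u, 0 <= f u) ->
  \esum_(u in [set: T]) f u = \sum_(n <oo) oapp f 0 (pickle_inv n).
Proof.
move=> f0; rewrite nneseries_esum; last by move=> n _; case: pickle_inv.
pose g n := oapp f 0 (@pickle_inv T n).
have fg u : f u = g (pickle u) by rewrite /g pickleK_inv.
have bij : set_bij [set: T] (range (@pickle T)) pickle.
  split=> [u _|u v _ _ /(congr1 (@unpickle T))|//]; first by exists u.
  by rewrite !pickleK => -[].
rewrite (eq_esum (fun u _ => fg u)) -(@reindex_esum _ _ _ _ _ _ g bij).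
rewrite esum_mkcond [RHS]esum_mkcond; apply: eq_esum => n _.
rewrite [X in _ = if X then _ else _]mem_set//.
case: ifPn => // /negP nn; rewrite /g; case E : pickle_inv => [u|]//=.
by case: nn; rewrite inE; exists u => //; have := @pickle_invK T n; rewrite E.
Qed.

(** Enumerating the countable index turns the sum into a series of measurable functions; codes
    outside the range of [pickle] contribute 0. *)
Lemma emeasurable_esum (R : realType) dX (X : measurableType dX) (T : countType)
    (f : T -> X -> \bar R) : (forall u x, 0 <= f u x) ->
  (forall u, measurable_fun setT (f u)) ->
  measurable_fun setT (fun x => \esum_(u in [set: T]) f u x).
Proof.
move=> f0 mf.
have -> : (fun x => \esum_(u in [set: T]) f u x) =
    (fun x => \sum_(n <oo) oapp (f^~ x) 0 (@pickle_inv T n)).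
  by apply/funext => x; rewrite esum_pickle.
apply: (@ge0_emeasurable_sum _ _ _ setT
  (fun n x => oapp (f^~ x) 0 (@pickle_inv T n)) xpredT).
  by move=> n x _ _; case: (pickle_inv n) => //= u; exact: f0.
by move=> n _; case: (pickle_inv n) => [u|]; [exact: mf|exact: measurable_cst].
Qed.

Section measure_tools.
Context (R : realType) (dO : measure_display) (Om : measurableType dO).
Implicit Types (Pr : probability Om R).

Lemma measure_partition (mu : measure Om R) (f : Om -> nat) D : measurable D ->
  (forall n, measurable (f @^-1` [set n])) ->
  mu D = \sum_(n <oo) mu (D `&` f @^-1` [set n]).
Proof.
move=> mD mf; rewrite -measure_semi_bigcup.
- by rewrite -setI_bigcupr -preimage_bigcup (_ : \bigcup_i _ = setT) ?setIT//;
    apply/seteqP; split=> // n _; exists n.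
- by move=> n; exact: measurableI.
- apply/trivIsetP => i j _ _ ij; apply/seteqP; split=> // w [[_ /= fi] [_ /= fj]].
  by move: ij; rewrite -fi -fj eqxx.
- by rewrite -setI_bigcupr; apply: measurableI => //; exact: bigcup_measurable.
Qed.

Lemma ge0_integral_mrestr dX (X : measurableType dX) (mu : measure X R) D (mD : measurable D)
    (f : X -> \bar R) : measurable_fun setT f -> (forall x, 0 <= f x) ->
  \int[mrestr mu mD]_x f x = \int[mu]_(x in D) f x.
Proof.
move=> mf f0; rewrite -(setvU D) ge0_integral_setU//; last 3 first.
- exact: measurableC.
- by rewrite setvU.
- by apply/disj_setPS; rewrite setICl.
rewrite null_set_integral ?add0e//; last 3 first.
- exact: measurableC.
- exact: measurable_funTS.
- by rewrite /= /mrestr setICl measure0.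
by apply: eq_measure_integral => A mA AD; rewrite /= /mrestr setIidl.
Qed.

(** Makes the law of [K] on the event [D] a measure, so that relations known for all measurable sets
    of states extend to integrals of non-negative functions. *)
Lemma measure_law dX (X : measurableType dX) (mu : measure Om R) (K : Om -> X) D :
  measurable D -> measurable_fun setT K ->
  exists2 m : measure X R, (forall A, m A = mu (D `&` K @^-1` A)) &
    forall f : X -> \bar R, measurable_fun setT f -> (forall x, 0 <= f x) ->
      \int[m]_x f x = \int[mu]_(w in D) f (K w).
Proof.
move=> mD mK.
unshelve eexists [the measure X R of pushforward (mrestr mu mD) K]; first exact: mK.
  by move=> A; rewrite /= /pushforward /mrestr setIC.
move=> f mf f0; rewrite ge0_integral_pushforward//.
rewrite preimage_setT ge0_integral_mrestr//.
  exact: measurableT_comp.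
by move=> w; exact: f0.
Qed.

(** Used with [p] the probability of the past: regeneration known on events is passed through a
    kernel to the next time, or through the exponential of a cycle. *)
Lemma integral_transfer dX (X : measurableType dX) (mu : measure Om R) (J J' : Om -> X) D D'
    (p : R) (f : X -> \bar R) :
  measurable D -> measurable D' -> measurable_fun setT J -> measurable_fun setT J' ->
  (0 <= p)%R ->
  (forall A, measurable A -> mu (D `&` J @^-1` A) = p%:E * mu (D' `&` J' @^-1` A)) ->
  measurable_fun setT f -> (forall x, 0 <= f x) ->
  \int[mu]_(w in D) f (J w) = p%:E * \int[mu]_(w in D') f (J' w).
Proof.
move=> mD mD' mJ mJ' p0 DD' mf f0.
have [m mE mI] := measure_law mu mD mJ.
have [m' mE' mI'] := measure_law mu mD' mJ'.
rewrite -mI// -mI'// -(@ge0_integral_mscale _ _ _ _ _ _ (NngNum p0))//.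
by apply: eq_measure_integral => A mA _; rewrite /= /mscale/= mE mE' DD'.
Qed.

(** Propagates a domination of an occupation measure by [m] through one transition [f]; it drives
    the induction behind recurrence. *)
Lemma sum_integral_le dX (X : measurableType dX) (mu : measure Om R) (n : nat)
    (J : nat -> Om -> X) (D : nat -> set Om) (m : measure X R) (c : R) (f : X -> \bar R) :
  (forall l, measurable (D l)) -> (forall l, measurable_fun setT (J l)) -> (0 <= c)%R ->
  (forall A, measurable A -> c%:E * \sum_(l < n) mu (D l `&` J l @^-1` A) <= m A) ->
  measurable_fun setT f -> (forall x, 0 <= f x) ->
  c%:E * \sum_(l < n) \int[mu]_(w in D l) f (J l w) <= \int[m]_x f x.
Proof.
move=> mD mJ c0 Dm mf f0.
have /choice[nu nuP] : forall l, exists nu : measure X R,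
    (forall A, nu A = mu (D l `&` J l @^-1` A)) /\
    \int[nu]_x f x = \int[mu]_(w in D l) f (J l w).
  move=> l; have [nu nuE nuI] := measure_law mu (mD l) (mJ l).
  by exists nu; split=> //; exact: nuI.
under eq_bigr do rewrite -(nuP _).2.
rewrite -ge0_integral_measure_sum// -(@ge0_integral_mscale _ _ _ _ _ _ (NngNum c0))//.
apply: ge0_le_measure_integral => // A mA; rewrite /= /mscale/= /msum.
by apply: le_trans (Dm A mA); under eq_bigr do rewrite (nuP _).1.
Qed.

End measure_tools.

(** * Exponential moments *)

Section dotr_theory.
Context (R : realType) (d : nat).
Implicit Types a b z : 'rV[R]_d.

Lemma dotr0l z : dotr 0 z = 0%R.
Proof. by rewrite /dotr big1// => i _; rewrite mxE mul0r. Qed.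

Lemma dotrC a b : dotr a b = dotr b a.
Proof. by rewrite /dotr; apply: eq_bigr => i _; rewrite mulrC. Qed.

Lemma dotrDl a b z : dotr (a + b)%R z = (dotr a z + dotr b z)%R.
Proof. by rewrite /dotr -big_split; apply: eq_bigr => i _; rewrite mxE mulrDl. Qed.

Lemma dotrZl (s : R) a z : dotr (s *: a)%R z = (s * dotr a z)%R.
Proof. by rewrite /dotr mulr_sumr; apply: eq_bigr => i _; rewrite mxE mulrA. Qed.

Lemma dotr_delta (s : R) i z : dotr (s *: delta_mx 0 i)%R z = (s * z 0%R i)%R.
Proof.
rewrite /dotr (bigD1 i)//= big1 ?addr0; last first.
  by move=> j ji; rewrite !mxE (negbTE ji) andbF mulr0 mul0r.
by rewrite !mxE !eqxx mulr1.
Qed.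

Lemma dotrDr a (x y : 'rV[nat]_d) :
  dotr a (real_vec R (x + y)%R) = (dotr a (real_vec R x) + dotr a (real_vec R y))%R.
Proof.
by rewrite /dotr -big_split; apply: eq_bigr => i _; rewrite /= !mxE natrD mulrDr.
Qed.

End dotr_theory.

Lemma probability_integral1 (R : realType) (dO : measure_display) (Om : measurableType dO)
    (Pr : probability Om R) (A : set Om) :
  measurable A -> \int[Pr]_(w in A) 1 = Pr A.
Proof. by move=> mA; rewrite integral_cst// mul1e. Qed.

Section exponential_moments.
Context (R : realType) (d : nat) (dO : measure_display) (Om : measurableType dO).
Variables (Pr : probability Om R) (S : nat -> Om -> 'rV[nat]_d) (M : 'rV[R]_d -> R).
Hypothesis mS : forall n (A : set 'rV[nat]_d), measurable (S n @^-1` A).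
Hypothesis ES : forall theta n,
  \int[Pr]_w (expR (dotr theta (real_vec R (S n w))))%:E = (M theta ^+ n)%:E.

Let measurable_funS n D (f : 'rV[nat]_d -> \bar R) :
  measurable D -> measurable_fun D (f \o S n).
Proof. by move=> mD _ B mB; apply: measurableI => //; exact: (mS n (f @^-1` B)). Qed.

Lemma exp_moment_gt0 theta : (0 < M theta)%R.
Proof.
rewrite lt0r; apply/andP; split; last first.
  rewrite -lee_fin -(expr1 (M theta)) -ES.
  by apply: integral_ge0 => w _; rewrite lee_fin expR_ge0.
apply/eqP => M0; have := ES theta 1%N.
rewrite expr1 M0 => /eqP; apply/negP.
apply/eqP => h0.
have mf := @measurable_funS 1 setT
  (fun z => (expR (dotr theta (real_vec R z)))%:E) measurableT.
have /(ae_eq_integral_abs Pr measurableT mf) :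
    \int[Pr]_w `|(expR (dotr theta (real_vec R (S 1 w))))%:E| = 0.
  rewrite -[RHS]h0; apply: eq_integral => w _.
  by rewrite gee0_abs ?lee_fin ?expR_ge0.
move=> h; have : Pr setT = 0.
  apply/negligibleP => //; move: h; congr (Pr.-negligible _).
  apply/seteqP; split => // w _ /= /(_ I) [] /eqP.
  by rewrite gt_eqF// expR_gt0.
by rewrite probability_setT => -[] /eqP; rewrite oner_eq0.
Qed.

Lemma exp_moment0 : M 0 = 1%R.
Proof.
have := ES 0 1; rewrite expr1.
under eq_integral do rewrite dotr0l expR0.
by rewrite probability_integral1// probability_setT => -[].
Qed.

Lemma chernoff theta n A b :
  (forall z, A z -> b <= dotr theta (real_vec R z))%R ->
  Pr (S n @^-1` A) <= (M theta ^+ n * expR (- b))%:E.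
Proof.
move=> Ab; rewrite -probability_integral1//.
pose g w : \bar R := (expR (- b) * expR (dotr theta (real_vec R (S n w))))%:E.
have mg : measurable_fun setT g.
  exact: (@measurable_funS n setT (fun z => (expR (- b) * expR (dotr theta (real_vec R z)))%:E)).
have g0 w : 0 <= g w by rewrite lee_fin mulr_ge0 ?expR_ge0.
apply: (@le_trans _ _ (\int[Pr]_(w in S n @^-1` A) g w)).
  apply: ge0_le_integral => //; first by apply: measurable_funTS.
  by move=> w /Ab h; rewrite lee_fin -expRD -expR0 ler_expR; lra.
apply: (@le_trans _ _ (\int[Pr]_w g w)); first exact: ge0_subset_integral.
under eq_integral do rewrite /g EFinM.
rewrite ge0_integralZl//; first by rewrite ES -EFinM mulrC.
exact: (@measurable_funS n setT (fun z => (expR (dotr theta (real_vec R z)))%:E)).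
Qed.

(** Stands in for a change of measure: with [A] a box around the tilted mean and the [t j] small
    perturbations of [theta] across its faces, the tilted mass is either on [A] or counted by a
    perturbed moment. *)
Lemma exp_moment_split (J : finType) theta n (A : set 'rV[nat]_d) (a : R) (c : J -> R)
    (t : J -> 'rV[R]_d) : (0 <= a)%R -> (forall j, 0 <= c j)%R ->
  (forall z, expR (dotr theta (real_vec R z)) <=
    a * \1_A z + \sum_j c j * expR (dotr (t j) (real_vec R z)))%R ->
  (M theta ^+ n)%:E <= a%:E * Pr (S n @^-1` A) + (\sum_j c j * M (t j) ^+ n)%:E.
Proof.
move=> a0 c0 h; rewrite -ES.
pose f1 w : \bar R := (a * \1_A (S n w))%:E.
pose f2 j w : \bar R := (c j * expR (dotr (t j) (real_vec R (S n w))))%:E.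
have mf1 : measurable_fun setT f1 by exact: (@measurable_funS n setT (fun z => (a * \1_A z)%:E)).
have mf2 j : measurable_fun setT (f2 j).
  exact: (@measurable_funS n setT (fun z => (c j * expR (dotr (t j) (real_vec R z)))%:E)).
have f10 w : 0 <= f1 w by rewrite lee_fin mulr_ge0.
have f20 j w : 0 <= f2 j w by rewrite lee_fin mulr_ge0 ?expR_ge0.
have -> : a%:E * Pr (S n @^-1` A) = \int[Pr]_w f1 w.
  rewrite -[in LHS](setIT (_ @^-1` _)) -integral_indic// -ge0_integralZl//.
  by apply/measurable_EFinP; exact: measurable_indic.
have -> : (\sum_j c j * M (t j) ^+ n)%:E = \int[Pr]_w \sum_j f2 j w.
  rewrite ge0_integral_sum// -sumEFin; apply: eq_bigr => j _.
  under eq_integral do rewrite /f2 EFinM.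
  rewrite ge0_integralZl//; first by rewrite ES EFinM.
    exact: (@measurable_funS n setT (fun z => (expR (dotr (t j) (real_vec R z)))%:E)).
  by rewrite lee_fin.
rewrite -ge0_integralD//; last 2 first.
- by move=> w _; exact: sume_ge0.
- exact: emeasurable_sum.
apply: ge0_le_integral => //.
- exact: (@measurable_funS n setT (fun z => (expR (dotr theta (real_vec R z)))%:E)).
- by apply: emeasurable_funD => //; exact: emeasurable_sum.
- by move=> w _; rewrite /f1 /f2 sumEFin -EFinD lee_fin.
Qed.

Let e theta w := expR (dotr theta (real_vec R (S 1 w))).

Let me theta : measurable_fun setT (EFin \o e theta).
Proof.
exact: (@measurable_funS 1 setT (fun z => (expR (dotr theta (real_vec R z)))%:E)).
Qed.

Let Re theta : \int[Pr]_w (e theta w)%:E = (M theta)%:E.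
Proof. by rewrite -(expr1 (M theta)) -ES. Qed.

Let ie theta : Pr.-integrable setT (EFin \o e theta).
Proof.
apply/integrableP; split; first exact: me.
under eq_integral do rewrite gee0_abs ?lee_fin ?expR_ge0//.
by rewrite Re ltry.
Qed.

Let ReM theta : (\int[Pr]_w e theta w)%R = M theta.
Proof. by rewrite /Rintegral Re. Qed.

Let iZ k f : Pr.-integrable setT (EFin \o f) ->
  Pr.-integrable setT (EFin \o (fun w => k * f w)%R).
Proof. by move=> h; exact: (integrableZl measurableT k h). Qed.

Let iD f g : Pr.-integrable setT (EFin \o f) -> Pr.-integrable setT (EFin \o g) ->
  Pr.-integrable setT (EFin \o (fun w => f w + g w)%R).
Proof. by move=> hf hg; exact: (integrableD measurableT hf hg). Qed.

Lemma exp_moment_le theta a b c :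
  (forall w, e theta w <= e a w + c * e b w)%R -> (M theta <= M a + c * M b)%R.
Proof.
move=> h; rewrite -!ReM -RintegralZl// -RintegralD//; last exact: iZ.
by apply: le_Rintegral => //; apply: iD => //; exact: iZ.
Qed.

Let U (z : 'rV[nat]_d) : R := dotr (const_mx 1)%R (real_vec R z).

Let U0 z : (0 <= U z)%R.
Proof. by apply: sumr_ge0 => i _; rewrite !mxE mul1r. Qed.

Let dotr_bnd (h : 'rV[R]_d) (s : R) z : (forall i, `|h 0%R i| <= s)%R ->
  (`|dotr h (real_vec R z)| <= s * U z)%R.
Proof.
move=> hs; rewrite /U /dotr mulr_sumr; apply: le_trans (ler_norm_sum _ _ _) _.
apply: ler_sum => i _; rewrite normrM [real_vec R z _ _]mxE [const_mx _ _ _]mxE mul1r.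
by rewrite (ger0_norm (ler0n _ _)) ler_wpM2r.
Qed.

(** Coordinates in N^d are non-negative, so the coordinate sum [U z] controls every [dotr h z], and
    the single exponential [expR (U z)] dominates all perturbations. The lower half uses
    [1 + D <= expR D], the upper half the convexity bound [expR (s * u) <= 1 + s * (expR u - 1)]. *)
Lemma exp_moment_lipschitz theta (h : 'rV[R]_d) (s : R) : (0 <= s <= 1)%R ->
  (forall i, `|h 0%R i| <= s)%R ->
  (`|M (theta + h) - M theta| <= s * M (theta + const_mx 1))%R.
Proof.
move=> /andP[s0 s1] hs; rewrite ler_distl; apply/andP; split.
  rewrite lerBlDr; apply: exp_moment_le => w.
  rewrite /e !dotrDl -/(U _) !expRD.
  set x := expR (dotr theta _); have x0 : (0 < x)%R by exact: expR_gt0.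
  have := dotr_bnd (S 1 w) hs; rewrite ler_norml => /andP[hl _].
  set D := dotr h _ in hl *; set u := U _ in hl *.
  have uE : (u <= expR u)%R by have := expR_ge1Dx u; lra.
  have DE : (1 + D <= expR D)%R := expR_ge1Dx D.
  have : (0 <= x * (expR D + s * expR u - 1))%R.
    apply: mulr_ge0; first exact: ltW.
    have : (s * u <= s * expR u)%R by rewrite ler_wpM2l.
    lra.
  by rewrite mulrBr mulrDr mulr1; lra.
apply: exp_moment_le => w.
rewrite /e !dotrDl -/(U _) !expRD.
set x := expR (dotr theta _); have x0 : (0 < x)%R by exact: expR_gt0.
have := dotr_bnd (S 1 w) hs; rewrite ler_norml => /andP[_ hl].
set D := dotr h _ in hl *; set u := U _ in hl *.
have DE : (expR D <= 1 + s * expR u)%R.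
  apply: (@le_trans _ _ (expR (s * u))); first by rewrite ler_expR.
  have := convex_expR (Itv01 s0 s1) u 0%R.
  rewrite !convRE/= expR0 mulr0 addr0 mulr1 => /le_trans; apply.
  by rewrite /unstable.onem; lra.
have : (0 <= x * (1 + s * expR u - expR D))%R.
  by apply: mulr_ge0; [exact: ltW|lra].
by rewrite mulrBr mulrDr mulr1; lra.
Qed.

(** [D] is the derivative E[y exp(theta . S_1)], y being coordinate [i] of S_1, and [K] is [M] at
    [theta + 3 e_i]: for [y >= 0] and [|s| <= 1] the Taylor remainder is at most [s^2 y^2 exp y],
    and [y^2 exp y <= exp (3 y)]. *)
Lemma exp_moment_directional theta i : exists D K : R, forall s, (`|s| <= 1)%R ->
  (M (theta + s *: delta_mx 0 i) <= M theta + s * D + s ^+ 2 * K)%R.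
Proof.
pose y w : R := real_vec R (S 1 w) 0%R i.
pose f w : R := (y w * e theta w)%R.
have y0 w : (0 <= y w)%R by rewrite /y mxE.
pose b := (theta + 3 *: delta_mx 0 i)%R.
have be w : e b w = (e theta w * expR (3 * y w))%R.
  by rewrite /e dotrDl dotr_delta expRD.
have yE w : (y w <= expR (y w))%R by have := expR_ge1Dx (y w); lra.
have E1 w : (1 <= expR (y w))%R by have := expR_ge1Dx (y w); have := y0 w; lra.
have E3 w : (expR (3 * y w) = expR (y w) ^+ 3)%R by rewrite -expRM_natl.
have intf : Pr.-integrable setT (EFin \o f).
  apply: (@le_integrable _ _ _ _ _ _ _ (EFin \o e b)) => //.
    exact: (@measurable_funS 1 setT
      (fun z => (real_vec R z 0%R i * expR (dotr theta (real_vec R z)))%:E)).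
  move=> w _; rewrite /= lee_fin !ger0_norm ?mulr_ge0 ?expR_ge0//.
  rewrite /f be mulrC ler_wpM2l ?expR_ge0// E3.
  apply: (le_trans (yE w)); rewrite -[leLHS]expr1.
  exact: ler_weXn2l.
exists (\int[Pr]_w f w)%R, (M b) => s; rewrite ler_norml => /andP[s1 s2].
rewrite -!ReM -!RintegralZl// -!RintegralD//; last 3 first.
- by apply: iD => //; exact: iZ.
- exact: iZ.
- exact: iZ.
apply: le_Rintegral => //.
  by apply: iD; [apply: iD => //|]; exact: iZ.
move=> w _; rewrite be /f {1}/e dotrDl dotr_delta -/(y w) expRD -/(e theta w).
set x := e theta w; have x0 : (0 < x)%R by exact: expR_gt0.
suff h : (expR (s * y w) <= 1 + s * y w + s ^+ 2 * expR (3 * y w))%R.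
  have : (0 <= x * (1 + s * y w + s ^+ 2 * expR (3 * y w) - expR (s * y w)))%R.
    by apply: mulr_ge0; [exact: ltW|lra].
  by rewrite !(mulrBr, mulrDr) mulr1; lra.
(* With v = s y, exp (- v) >= 1 - v gives exp v - 1 <= v exp v, hence
   exp v <= 1 + v + v (exp v - 1) <= 1 + v + v^2 exp |v|. *)
set v := (s * y w)%R; set E := expR (y w).
have vE : (expR v <= E)%R by rewrite ler_expR /v; have := y0 w; nra.
have ev : (expR v - 1 <= v * expR v)%R.
  have h : (1 - v <= expR (- v))%R := expR_ge1Dx (- v).
  have : ((1 - v) * expR v <= expR (- v) * expR v)%R by rewrite ler_wpM2r ?expR_ge0.
  by rewrite -expRD addNr expR0; lra.
have v1 : (v <= expR v - 1)%R by have := expR_ge1Dx v; lra.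
have v2 : (v * (expR v - 1) <= v ^+ 2 * E)%R.
  have [v0|v0] := leP 0%R v.
    have : (v * (expR v - 1) <= v * (v * expR v))%R by rewrite ler_wpM2l.
    have : (v ^+ 2 * expR v <= v ^+ 2 * E)%R by rewrite ler_wpM2l// sqr_ge0.
    by rewrite expr2; lra.
  have : (v * (expR v - 1) <= v * v)%R by rewrite ler_wnM2l// ltW.
  have : (v ^+ 2 * 1 <= v ^+ 2 * E)%R by rewrite ler_wpM2l ?sqr_ge0 ?E1.
  by rewrite expr2; lra.
have y2 : (y w ^+ 2 <= E ^+ 2)%R by rewrite ler_sqr ?nnegrE ?expR_ge0.
have : (v ^+ 2 * E <= s ^+ 2 * expR (3 * y w))%R.
  rewrite E3 -/E /v exprMn -mulrA ler_wpM2l ?sqr_ge0// [leRHS]exprS mulrC.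
  by rewrite ler_wpM2l ?expR_ge0.
lra.
Qed.
End exponential_moments.

(** * Cramer bounds *)

Lemma dotr_continuous (R : realType) d (T : topologicalType) (f g : T -> 'rV[R]_d) :
  (forall i, continuous (fun x => f x 0%R i)) -> (forall i, continuous (fun x => g x 0%R i)) ->
  continuous (fun x => dotr (f x) (g x)).
Proof.
move=> cf cg x; apply: cvg_big; first exact: add_continuous.
by move=> i _; apply: cvgM; [exact: cf|exact: cg].
Qed.

(* Probed at s = - t a for small t > 0. *)
Lemma slope_eq0 (R : realFieldType) (a b : R) :
  (forall s, `|s| <= 1 -> 0 <= s * a + s ^+ 2 * b)%R -> a = 0%R.
Proof.
move=> h; apply/eqP; apply/negPn/negP => a0.
pose c := (`|b| + 1 + `|a|)%R.
have c0 : (0 < c)%R by rewrite /c; have := normr_ge0 a; have := normr_ge0 b; lra.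
have := h (- (a / c))%R; rewrite normrN normrM normfV (gtr0_norm c0).
rewrite ler_pdivrMr// mul1r => /(_ _)/wrap[].
  by rewrite /c; have := normr_ge0 b; lra.
have bc : (b < c)%R by rewrite /c; have := normr_ge0 a; have := ler_norm b; lra.
rewrite sqrrN exprMn exprVn.
have -> : (- (a / c) * a + a ^+ 2 / c ^+ 2 * b = a ^+ 2 / c ^+ 2 * (b - c))%R.
  by field; rewrite gt_eqF.
rewrite leNgt => /negP; apply; rewrite pmulr_rlt0 ?subr_lt0//.
by apply: divr_gt0; [rewrite exprn_even_gt0|rewrite exprn_gt0].
Qed.

Section cramer.
Context (R : realType) (d : nat) (dO : measure_display) (Om : measurableType dO).
Variables (Pr : probability Om R) (S : nat -> Om -> 'rV[nat]_d) (M : 'rV[R]_d -> R).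
Hypothesis mS : forall n (A : set 'rV[nat]_d), measurable (S n @^-1` A).
Hypothesis ES : forall theta n,
  \int[Pr]_w (expR (dotr theta (real_vec R (S n w))))%:E = (M theta ^+ n)%:E.

Let M_gt0 := exp_moment_gt0 mS ES.
Let M0 := exp_moment0 ES.

Lemma exp_moment_continuous : continuous M.
Proof.
move=> theta; apply/(@cvgrPdist_le _ _ _ (nbhs theta)) => eps eps0.
pose s := Num.min 1%R (eps / M (theta + const_mx 1))%R.
have s0 : (0 < s)%R by rewrite lt_min ltr01 divr_gt0.
have s1 : (s <= 1)%R by rewrite ge_min lexx.
apply/nbhs_ballP; exists s => //= eta.
move=> /= bx; have := @exp_moment_lipschitz _ _ _ _ _ _ _ mS ES theta (eta - theta)%R s.
rewrite (addrC eta) addNKr distrC => H.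
apply: le_trans (H _ _) _; first by rewrite ltW.
  by move=> i; have [_ /(_ 0%R i)] := bx; rewrite /ball/= !mxE addrC distrC => /ltW.
by rewrite -ler_pdivlMr// ge_min lexx orbT.
Qed.

Lemma exposed_point_near (y : 'rV[R]_d) (I delta : R) : (0 < delta)%R ->
  (forall theta, dotr theta y - ln (M theta) <= I)%R ->
  exists theta p : 'rV[R]_d, [/\ forall i, (`|p 0%R i - y 0%R i| <= delta)%R,
    (dotr theta p - ln (M theta) <= I)%R &
    exists2 K : R, (0 <= K)%R & forall i s, (`|s| <= 1)%R ->
      (M (theta + s *: delta_mx 0 i) <= M theta * expR (s * p 0%R i + s ^+ 2 * K))%R].
Proof.
move=> delta0 yI.
have I0 : (0 <= I)%R by have := yI 0%R; rewrite dotr0l M0 ln1 subr0.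
(* From [g c <= g 0 = 0] and [yI], the minimizer [c] found below has [e * dotr c c <= 2 * I]; hence
   [e *: c] has squared length at most [2 * e * I], which this choice of [e] keeps within
   [delta ^+ 2]. *)
have [e e0 eI] : exists2 e : R, (0 < e)%R & (2 * e * I <= delta ^+ 2)%R.
  set c := (delta ^+ 2)%R; have c0 : (0 < c)%R by rewrite exprn_gt0.
  exists (c / (2 * (I + 1)))%R; first by rewrite divr_gt0//; lra.
  have -> : (2 * (c / (2 * (I + 1))) * I = c * (I / (I + 1)))%R by field; rewrite gt_eqF//; lra.
  by rewrite ler_piMr ?(ltW c0)// ler_pdivrMr; lra.
pose g theta := (ln (M theta) - dotr theta y + e / 2 * dotr theta theta)%R.
have cc (i : 'I_d) : continuous (fun x : 'rV[R]_d => x 0%R i) by exact: coord_continuous.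
have c1 : continuous (fun t => ln (M t)).
  by move=> t; apply: (@continuous_comp _ _ _ M (@ln R));
     [exact: exp_moment_continuous|exact: continuous_ln].
have c2 : continuous (fun t : 'rV[R]_d => dotr t y).
  by apply: (@dotr_continuous _ _ _ id (fun=> y)) => // i; exact: cst_continuous.
have c3 : continuous (fun t : 'rV[R]_d => e / 2 * dotr t t)%R.
  move=> t; apply: (@continuousM _ _ (fun=> e / 2)%R (fun t : 'rV[R]_d => dotr t t)).
    exact: cst_continuous.
  exact: (@dotr_continuous _ _ _ id id).
have cg : continuous g := fun t => continuousD (continuousB (c1 t) (c2 t)) (c3 t).
have sq_ge (z : 'rV[R]_d) i : (z 0%R i ^+ 2 <= dotr z z)%R.
  rewrite /dotr (bigD1 i)//= -expr2 lerDl; apply: sumr_ge0 => j _.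
  by rewrite -expr2 sqr_ge0.
(* Outside the cube of half-width [A >= 1] one has [dotr t t >= A ^+ 2 >= A], and
   [e / 2 * A = e / 2 + I] outweighs the loss of at most [I] allowed by [yI], so [g] is positive
   there. *)
pose A := (1 + 2 * I / e)%R.
have A1 : (1 <= A)%R by rewrite lerDl; apply: divr_ge0; [exact: mulr_ge0|exact: ltW].
pose B := [set v : 'rV[R]_d | forall i, `[(- A)%R, A]%classic (v ord0 i)].
have [c cB gc] : exists2 c, c \in B & forall t, t \in B -> (g c <= g t)%R.
  apply: compact_EVT_min.
  - by exists 0%R => i; rewrite /= mxE in_itv/=; apply/andP; split; lra.
  - by apply: (@rV_compact _ _ (fun=> `[(- A)%R, A]%classic)) => i; exact: segment_compact.
  - exact: continuous_subspaceT.
have g0 : g 0%R = 0%R by rewrite /g !dotr0l M0 ln1; ring.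
have gc0 : (g c <= 0)%R.
  rewrite -g0; apply: gc; rewrite inE => i /=.
  by rewrite mxE in_itv/=; apply/andP; split; lra.
have {gc} gmin t : (g c <= g t)%R.
  have [tB|/existsNP[i ti]] := pselect (B t); first by apply: gc; rewrite inE.
  apply: le_trans gc0 _.
  have tA : (A < `|t 0%R i|)%R.
    rewrite ltNge; apply/negP => tA; apply: ti.
    by move: tA; rewrite /= in_itv/= ler_norml.
  have : (e / 2 * A <= e / 2 * dotr t t)%R.
    rewrite ler_wpM2l ?divr_ge0 ?(ltW e0)//.
    apply: le_trans (sq_ge t i); rewrite -real_normK ?num_real// expr2.
    have : (A * 1 <= `|t 0%R i| * `|t 0%R i|)%R by apply: ler_pM; lra.
    by rewrite mulr1.
  have -> : (e / 2 * A = e / 2 + I)%R by rewrite /A; field; rewrite gt_eqF.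
  by have := yI t; rewrite /g; lra.
pose p := (y - e *: c)%R.
have pE i : (p 0%R i = y 0%R i - e * c 0%R i)%R by rewrite !mxE.
have dcp : (dotr c p = dotr c y - e * dotr c c)%R.
  rewrite /dotr mulr_sumr -sumrB; apply: eq_bigr => i _; rewrite pE; ring.
have cc0 : (0 <= dotr c c)%R by apply: sumr_ge0 => i _; rewrite -expr2 sqr_ge0.
have ecc0 : (0 <= e * dotr c c)%R by rewrite mulr_ge0// ltW.
exists c, p; split.
- move=> i; rewrite pE addrAC subrr add0r normrN.
  rewrite -ler_sqr ?nnegrE ?normr_ge0 ?(ltW delta0)// real_normK ?num_real//.
  apply: le_trans eI; rewrite exprMn.
  apply: (@le_trans _ _ (e * (e * dotr c c))%R).
    by rewrite expr2 -mulrA ler_wpM2l ?(ltW e0)// ler_wpM2l ?(ltW e0)// sq_ge.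
  rewrite (mulrC 2%R) -mulrA ler_wpM2l ?(ltW e0)//.
  by have := yI c; move: gc0; rewrite /g; lra.
- by have := yI c; rewrite dcp; lra.
have /choice[D /choice[K DK]] := @exp_moment_directional _ _ _ _ _ _ _ mS ES c.
have Mc := M_gt0 c.
(* Stationarity: minimality of [g] at [c], with the second-order upper bound for [M], makes a
   quadratic polynomial in [s] non-negative near 0, so its linear coefficient [D i / M c - p i]
   vanishes. *)
have Dp i : (D i / M c = p 0%R i)%R.
  apply/eqP; rewrite -subr_eq0; apply/eqP.
  apply: (@slope_eq0 _ _ (K i / M c + e / 2)) => s s1.
  have := gmin (c + s *: delta_mx 0 i)%R.
  have -> : g (c + s *: delta_mx 0 i)%R = (ln (M (c + s *: delta_mx 0 i)) - dotr c y
      - s * y 0 i + e / 2 * (dotr c c + 2 * s * c 0 i + s ^+ 2))%R.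
    have dcc : dotr (c + s *: delta_mx 0 i)%R (c + s *: delta_mx 0 i)%R =
        (dotr c c + 2 * s * c 0 i + s ^+ 2)%R.
      rewrite dotrDl dotr_delta (dotrC c) dotrDl dotr_delta !mxE !eqxx/=.
      by ring.
    by rewrite /g dcc dotrDl dotr_delta; ring.
  have : (ln (M (c + s *: delta_mx 0 i)) <= ln (M c) + (s * (D i / M c) + s ^+ 2 * (K i / M c)))%R.
    rewrite -ler_expR expRD !lnK ?posrE//; apply: le_trans (DK i s s1) _.
    set x := (s * _ + _)%R.
    have -> : (M c + s * D i + s ^+ 2 * K i = M c * (1 + x))%R.
      by rewrite /x; field; rewrite gt_eqF.
    by rewrite ler_wpM2l ?expR_ge1Dx ?ltW.
  by rewrite pE /g; lra.
exists (\sum_i `|K i / M c|)%R; first by apply: sumr_ge0.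
move=> i s s1; apply: le_trans (DK i s s1) _.
set K' := (\sum_i _)%R.
have KK : (K i / M c <= K')%R.
  apply: le_trans (ler_norm _) _; rewrite /K' (bigD1 i)//= lerDl.
  exact: sumr_ge0.
have -> : (M c + s * D i + s ^+ 2 * K i = M c * (1 + (s * p 0 i + s ^+ 2 * (K i / M c))))%R.
  by rewrite -Dp; field; rewrite gt_eqF.
rewrite ler_wpM2l ?(ltW Mc)//; apply: le_trans (expR_ge1Dx _) _.
by rewrite ler_expR lerD2l ler_wpM2l ?sqr_ge0.
Qed.

Lemma expRN_le_div (c x : R) : (0 < c)%R -> (c^-1 <= x)%R -> (expR (- x) <= c)%R.
Proof.
move=> c0 cx; rewrite expRN -(invrK c) lef_pV2 ?posrE ?invr_gt0 ?expR_gt0//.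
by apply: le_trans cx _; have := expR_ge1Dx x; lra.
Qed.

Lemma near_natrM_ge (k c : R) : (0 < k)%R -> \forall n \near \oo, (c <= n%:R * k)%R.
Proof.
move=> k0; near=> n; rewrite -ler_pdivrMr//.
by near: n; exact: nbhs_infty_ger.
Unshelve. all: by end_near. Qed.

(** [M theta ^+ n] is at most the largest weight on a box around [n p] times the probability of the
    box, plus moments perturbed across the [2 d] faces. The faces account for at most half, so the
    box carries the rest, and [pI] turns the weight into the rate [I]. *)
Lemma cramer_lower (y : 'rV[R]_d) (I delta eta : R) : (0 < delta)%R -> (0 < eta)%R ->
  (forall theta, dotr theta y - ln (M theta) <= I)%R ->
  \forall n \near \oo, (expR (- (n%:R * (I + eta))))%:E <= Pr (S n @^-1`
    [set z | forall i, (`|real_vec R z 0%R i - n%:R * y 0%R i| < n%:R * delta)%R]).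
Proof.
move=> delta0 eta0 yI.
have [theta [p [py pI [K K0 MK]]]] := exposed_point_near (divr_gt0 delta0 (@ltr0n R 2)) yI.
pose L := (\sum_i `|theta 0 i|)%R; have L0 : (0 <= L)%R by exact: sumr_ge0.
(* The box of radius [n * dl] about [n p] must lie in the given box about [n y], and [theta . z] may
   deviate on it from [n * dotr theta p] by at most [n * eta / 2]. The other half of [eta] pays for
   the factor 1/2 lost to the faces. *)
have [dl [dl0 dldelta dlL]] :
    exists dl : R, [/\ (0 < dl)%R, (dl <= delta / 2)%R & (dl * L <= eta / 2)%R].
  exists (Num.min (delta / 2) (eta / (2 * (L + 1))))%R; split.
  - by rewrite lt_min divr_gt0//= divr_gt0//; lra.
  - by rewrite ge_min lexx.
  - apply: (@le_trans _ _ (eta / (2 * (L + 1)) * L))%R.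
      by rewrite ler_wpM2r// ge_min lexx orbT.
    have -> : (eta / (2 * (L + 1)) * L = eta / 2 * (L / (L + 1)))%R.
      by field; rewrite gt_eqF//; lra.
    by rewrite ler_piMr ?divr_ge0 ?(ltW eta0)// ler_pdivrMr; lra.
(* Crossing a face gains [s0 * dl] per step at the second-order cost [s0 ^+ 2 * K]; the cost is kept
   to at most half of the gain, which leaves the rate [kap]. *)
have [s0 [s00 s01 s0K]] :
    exists s0 : R, [/\ (0 < s0)%R, (s0 <= 1)%R & (s0 * K <= dl / 2)%R].
  exists (Num.min 1 (dl / (2 * (K + 1))))%R; split.
  - by rewrite lt_min ltr01/= divr_gt0//; lra.
  - by rewrite ge_min lexx.
  - apply: (@le_trans _ _ (dl / (2 * (K + 1)) * K))%R.
      by rewrite ler_wpM2r// ge_min lexx orbT.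
    have -> : (dl / (2 * (K + 1)) * K = dl / 2 * (K / (K + 1)))%R.
      by field; rewrite gt_eqF//; lra.
    by rewrite ler_piMr ?divr_ge0 ?(ltW dl0)// ler_pdivrMr; lra.
pose kap := (s0 * dl / 2)%R.
have kap0 : (0 < kap)%R by rewrite divr_gt0// mulr_gt0.
near=> n.
pose G := [set z : 'rV[nat]_d | forall i, (`|real_vec R z 0%R i - n%:R * p 0%R i| < n%:R * dl)%R].
apply: (@le_trans _ _ (Pr (S n @^-1` G))); last first.
  apply: le_measure; rewrite ?inE; [exact: mS..|].
  move=> w /= Gw i; set z := real_vec R (S n w) 0%R i.
  have n0 : (0 <= n%:R :> R)%R by [].
  have -> : (z - n%:R * y 0 i = (z - n%:R * p 0 i) + n%:R * (p 0 i - y 0 i))%R by ring.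
  apply: le_lt_trans (ler_normD _ _) _; rewrite normrM (ger0_norm n0).
  have := Gw i; rewrite -/z => h.
  have : (n%:R * `|p 0 i - y 0 i| <= n%:R * (delta / 2))%R by rewrite ler_wpM2l.
  have : (n%:R * dl <= n%:R * (delta / 2))%R by rewrite ler_wpM2l.
  lra.
(* [a] bounds [exp (theta . z)] on [G]. Off [G] some face [(i, b)] is crossed, and [c] is normalized
   so that the perturbed exponential of that face is at least [exp (theta . z)] once
   [sg b * (z i - n * p i) >= n * dl]. *)
pose a : R := expR (n%:R * (dotr theta p + dl * L))%R.
pose sg (b : bool) : R := ((-1) ^+ b)%R.
pose t (j : 'I_d * bool) := (theta + (sg j.2 * s0) *: delta_mx 0 j.1)%R.
pose c (j : 'I_d * bool) : R := expR (- (n%:R * (s0 * (sg j.2 * p 0 j.1 + dl))))%R.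
have := @exp_moment_split _ _ _ _ _ _ _ mS ES _ theta n G a c t.
have Mt := M_gt0 theta.
move=> /(_ (expR_ge0 _) (fun=> expR_ge0 _)) /(_ _)/wrap[].
  move=> z; have [Gz|/existsNP[i Gz]] := pselect (G z).
    rewrite indicE mem_set// mulr1 ler_wpDr ?sumr_ge0//.
      by move=> j _; rewrite mulr_ge0 ?expR_ge0.
    rewrite ler_expR mulrDr -lerBlDl /dotr /L !mulr_sumr -sumrB.
    apply: ler_sum => i _.
    have -> : (theta 0 i * real_vec R z 0 i - n%:R * (theta 0 i * p 0 i) =
      theta 0 i * (real_vec R z 0 i - n%:R * p 0 i))%R by ring.
    apply: le_trans (ler_norm _) _; rewrite normrM mulrC mulrA.
    by rewrite ler_wpM2r// ltW// Gz.
  rewrite ler_wpDl ?mulr_ge0 ?expR_ge0//.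
  have [b zb] : exists b, (n%:R * dl <= sg b * (real_vec R z 0 i - n%:R * p 0 i))%R.
    move/negP: Gz; rewrite -leNgt ler_normr => /orP[h|h].
      by exists false; rewrite /sg expr0 mul1r.
    by exists true; rewrite /sg expr1 mulN1r.
  rewrite (bigD1 (i, b))//= ler_wpDr ?sumr_ge0//.
    by move=> j _; rewrite mulr_ge0 ?expR_ge0.
  rewrite /c /t/= -expRD ler_expR dotrDl dotr_delta.
  have : (s0 * (n%:R * dl) <= s0 * (sg b * (real_vec R z 0 i - n%:R * p 0 i)))%R.
    by rewrite ler_wpM2l// ltW.
  lra.
have tl (j : 'I_d * bool) : (c j * M (t j) ^+ n <= M theta ^+ n * expR (- (n%:R * kap)))%R.
  have sg2 : (sg j.2 ^+ 2 = 1)%R by rewrite /sg sqrr_sign.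
  have h : (M (t j) <= M theta * expR (sg j.2 * s0 * p 0 j.1 + s0 ^+ 2 * K))%R.
    rewrite /t; have := MK j.1 (sg j.2 * s0)%R; rewrite exprMn sg2 mul1r; apply.
    by rewrite normrM /sg normrX normrN1 expr1n mul1r gtr0_norm.
  have {}h : (M (t j) ^+ n <= M theta ^+ n * expR (n%:R * (sg j.2 * s0 * p 0 j.1 + s0 ^+ 2 * K)))%R.
    rewrite expRM_natl -exprMn; apply: lerXn2r h; rewrite nnegrE ?ltW//.
    by rewrite mulr_gt0 ?expR_gt0.
  apply: (@le_trans _ _ (c j * (M theta ^+ n *
      expR (n%:R * (sg j.2 * s0 * p 0 j.1 + s0 ^+ 2 * K)))))%R.
    by rewrite ler_wpM2l ?expR_ge0.
  rewrite mulrCA ler_wpM2l ?exprn_ge0 ?(ltW Mt)// /c -expRD ler_expR.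
  have : (s0 * (s0 * K) <= s0 * (dl / 2))%R by rewrite ler_wpM2l// ltW.
  move=> /(ler_wpM2l (ler0n R n)).
  rewrite /kap expr2; lra.
have tls : (\sum_j c j * M (t j) ^+ n <= M theta ^+ n / 2)%R.
  apply: (@le_trans _ _ (\sum_(j : 'I_d * bool) M theta ^+ n * expR (- (n%:R * kap))))%R.
    by apply: ler_sum => j _; exact: tl.
  rewrite sumr_const card_prod card_ord card_bool -[leLHS]mulr_natr -mulrA.
  rewrite ler_wpM2l ?exprn_ge0 ?(ltW Mt)//.
  (* The [2 d] faces, each at most a fraction [D^-1] of [M theta ^+ n], sum to less than one half of
     it; [d + 1] keeps [D] positive for every [d]. *)
  pose D : R := (4 * (d%:R + 1))%R.
  have D0 : (0 < D)%R by rewrite /D; have := ler0n R d; lra.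
  have : (expR (- (n%:R * kap)) <= D^-1)%R.
    rewrite expRN_le_div ?invr_gt0// invrK.
    by near: n; exact: near_natrM_ge.
  move=> h; apply: (@le_trans _ _ (D^-1 * (d * 2)%:R))%R; first by rewrite ler_wpM2r.
  rewrite mulrC ler_pdivrMr// natrM /D; have := ler0n R d; lra.
have Pfin : Pr (S n @^-1` G) \is a fin_num by exact: fin_num_measure.
rewrite -(fineK Pfin) -EFinM -EFinD lee_fin lee_fin => h.
have {}h : (M theta ^+ n / 2 <= a * fine (Pr (S n @^-1` G)))%R by lra.
have a0 : (0 < a)%R by exact: expR_gt0.
rewrite -(ler_pM2l a0); apply: le_trans h.
rewrite /a -expRD -[M theta]lnK ?posrE// -expRM_natl.
apply: (@le_trans _ _ (expR (n%:R * ln (M theta)) * expR (- (n%:R * (eta / 2)))))%R.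
  rewrite -expRD ler_expR.
  have := ler_wpM2l (ler0n R n) pI; have := ler_wpM2l (ler0n R n) dlL; lra.
rewrite ler_wpM2l ?expR_ge0// expRN_le_div ?invr_gt0// invrK.
by near: n; apply: near_natrM_ge; rewrite divr_gt0.
Unshelve. all: by end_near. Qed.

(** If [P K] failed, the sets whose complement in [K] satisfies [P] would form a proper filter
    containing [K]; a cluster point of it in [K] contradicts the local hypothesis. *)
Lemma compact_induction (T : topologicalType) (K : set T) (P : set T -> Prop) :
  compact K -> P set0 -> (forall A B, A `<=` B -> P B -> P A) ->
  (forall A B, P A -> P B -> P (A `|` B)) ->
  (forall x, K x -> exists2 U, nbhs x U & P U) -> P K.
Proof.
move=> cK P0 Psub PU Ploc; apply/not_notP => nPK.
pose F := [set A | P (K `\` A)].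
have FF : ProperFilter F.
  apply: Build_ProperFilter.
    by rewrite /F/= setD0.
  split.
  - by rewrite /F/= setDT.
  - by move=> A B FA FB; rewrite /F/= setDIr; exact: PU.
  - by move=> A B AB FA; apply: Psub FA => x [Kx Bx]; split=> // /AB.
have [|x [Kx clx]] := cK F FF; first by rewrite /F/= setDv.
have [U xU PUU] := Ploc x Kx.
have FU : F (~` U) by apply: Psub PUU => y [_ /contrapT].
by have [y [Uy]] := clx _ _ FU xU.
Qed.

(** After rescaling by [1 / N t], a point off [D] has a ball that the event eventually avoids, and a
    point of [D] has an open half-space on which Chernoff's bound has rate [c]. The property [good]
    is stable under finite unions because the constants [K] add up, and a constant factor is
    invisible on the logarithmic scale. *)
Lemma cramer_upper (T : Type) (F : set_system T) (FF : Filter F) (N : T -> nat)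
    (E : T -> set 'rV[nat]_d) (D : set 'rV[R]_d) (c : R) :
  (\forall t \near F, (0 < N t)%N) ->
  (forall y, ~ D y -> exists2 delta : R, (0 < delta)%R & \forall t \near F, forall z,
    (forall i, `|real_vec R z 0%R i - (N t)%:R * y 0%R i| < (N t)%:R * delta)%R -> ~ E t z) ->
  (forall y, D y -> exists theta, (c < dotr theta y - ln (M theta))%R) ->
  exists K : nat, \forall t \near F,
    Pr (S (N t) @^-1` E t) <= (K%:R * expR (- ((N t)%:R * c)))%:E.
Proof.
move=> N0 hE hD.
pose good (U : set 'rV[R]_d) := exists K : nat, \forall t \near F,
  Pr (S (N t) @^-1` [set z | E t z /\ U ((N t)%:R^-1 *: real_vec R z)%R]) <=
    (K%:R * expR (- ((N t)%:R * c)))%:E.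
have chern theta t A : (0 < N t)%N ->
    (forall z, A z -> ((N t)%:R * (c + ln (M theta)) <= dotr theta (real_vec R z))%R) ->
    Pr (S (N t) @^-1` A) <= (expR (- ((N t)%:R * c)))%:E.
  move=> Nt h; apply: (le_trans (chernoff mS ES (N t) h)); rewrite lee_fin.
  rewrite -[M theta]lnK ?posrE// -expRM_natl -expRD ler_expR expRK.
  by rewrite mulrDr; lra.
have cc (i : 'I_d) : continuous (fun x : 'rV[R]_d => x 0%R i) by exact: coord_continuous.
(* Each coordinate is at most the coordinate sum, so leaving the cube [[0, A]^d] forces the sum
   above [A], the threshold at which Chernoff's bound with [theta = (1, ..., 1)] has rate [c]. *)
pose A := (c + ln (M (const_mx 1)))%R.
pose B := [set v : 'rV[R]_d | forall i, `[0%R, A]%classic (v ord0 i)].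
have [K HK] : good B.
  apply: (@compact_induction 'rV[R]_d).
  - by apply: (@rV_compact _ _ (fun=> `[0%R, A]%classic)) => i; exact: segment_compact.
  - exists 0%N; apply: nearW => t; rewrite mul0r.
    by rewrite (_ : [set z | _] = set0) ?preimage_set0 ?measure0//; apply/seteqP; split=> // z [].
  - move=> U V UV [K HK]; exists K; apply: filterS HK => t; apply: le_trans.
    by apply: le_measure; rewrite ?inE; [exact: mS..|move=> w [? /UV]].
  - move=> U V [K HK] [L HL]; exists (K + L)%N; apply: filterS2 HK HL => t HK HL.
    rewrite natrD mulrDl EFinD; apply: le_trans (leeD HK HL).
    apply: le_trans (measureU2 _ _ _); [|exact: mS..].
    apply: le_measure; rewrite ?inE; [exact: mS|by apply: measurableU; exact: mS|].
    by move=> w [? []]; [left|right].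
  - move=> y _; have [Dy|nDy] := pselect (D y).
      have [theta ty] := hD y Dy.
      exists [set v | (c + ln (M theta) < dotr theta v)%R].
        have cd : {for y, continuous (fun v : 'rV[R]_d => dotr theta v)}.
          by apply: (@dotr_continuous _ _ _ (fun=> theta) id) => // i; exact: cst_continuous.
        apply: (cd [set x | (c + ln (M theta) < x)%R]).
        by apply: open_nbhs_nbhs; split; [exact: open_gt|rewrite /=; lra].
      exists 1%N; apply: filterS N0 => t Nt0; rewrite mul1r; apply: (chern theta) => //.
      have Nt : (0 < (N t)%:R :> R)%R by rewrite ltr0n.
      move=> z [_]; rewrite /= dotrC dotrZl dotrC => /ltW.
      by rewrite -ler_pdivlMl.
    have [delta delta0 hd] := hE y nDy.
    exists (ball y delta); first exact: nbhsx_ballx.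
    exists 0%N; apply: filterS2 hd N0 => t hd Nt0; rewrite mul0r.
    rewrite (_ : [set z | _] = set0) ?preimage_set0 ?measure0//.
    apply/seteqP; split=> // z [Ez [_ yz]].
    have Nt : (0 < (N t)%:R :> R)%R by rewrite ltr0n.
    apply: (hd z _ Ez) => i.
    have := yz 0%R i; rewrite /ball/= !mxE distrC => h.
    have -> : ((z 0 i)%:R - (N t)%:R * y 0 i =
      (N t)%:R * ((N t)%:R^-1 * (z 0 i)%:R - y 0 i))%R by field; rewrite gt_eqF.
    by rewrite normrM (gtr0_norm Nt) ltr_pM2l.
exists (K + 1)%N; apply: filterS2 HK N0 => t {}HK Nt0.
have Nt : (0 < (N t)%:R :> R)%R by rewrite ltr0n.
pose O := [set z : 'rV[nat]_d | ((N t)%:R * A <= dotr (const_mx 1) (real_vec R z))%R].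
rewrite natrD mulrDl mul1r EFinD.
apply: le_trans (leeD HK (@chern (const_mx 1%R) t O _ _)) => //.
apply: le_trans (measureU2 _ _ _); [|exact: mS..].
apply: le_measure; rewrite ?inE; [exact: mS|by apply: measurableU; exact: mS|].
move=> w Ew; have [Ow|nOw] := pselect (O (S (N t) w)); [by right|left; split=> // i].
move/negP: nOw; rewrite -ltNge -ltr_pdivrMl// => h.
rewrite /= in_itv/= !mxE mulr_ge0 ?invr_ge0//=; apply: le_trans (ltW h).
rewrite ler_wpM2l ?invr_ge0// /dotr (bigD1 i)//= !mxE mul1r lerDl.
by apply: sumr_ge0 => j _; rewrite !mxE mul1r.
Qed.

End cramer.

(** * One step of the split chain *)

Section history_theory.
Context (dO : measure_display) (Om : measurableType dO) (dE : measure_display)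
  (E : measurableType dE) (Z : nat -> Om -> E).

Let gens n : set_system Om := \bigcup_(i in [set i | (i <= n)%N])
  preimage_set_system setT (Z i) measurable.

Lemma historyT n : history Z n setT.
Proof. exact: (@measurableT _ (g_sigma_algebraType (gens n))). Qed.

Lemma historyI n A B : history Z n A -> history Z n B -> history Z n (A `&` B).
Proof. exact: (@measurableI _ (g_sigma_algebraType (gens n))). Qed.

Lemma historyC n A : history Z n A -> history Z n (~` A).
Proof. exact: (@measurableC _ (g_sigma_algebraType (gens n))). Qed.

Lemma history_bigcup n (T : Type) (F : T -> set Om) : countable [set: T] ->
  (forall t, history Z n (F t)) -> history Z n (\bigcup_t F t).
Proof. exact: (@countable_bigcupT_measurable _ (g_sigma_algebraType (gens n))). Qed.

Lemma history_preimage n i B : (i <= n)%N -> measurable B -> history Z n (Z i @^-1` B).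
Proof.
move=> ni mB; apply: sub_gen_smallest; exists i => //.
by exists B => //; rewrite setTI.
Qed.

Lemma history_mono m n A : (m <= n)%N -> history Z m A -> history Z n A.
Proof.
move=> mn; apply: smallest_sub; first exact: smallest_sigma_algebra.
by move=> _ [i /= im [B mB <-]]; rewrite setTI; apply: history_preimage => //; exact: leq_trans mn.
Qed.

Lemma history_measurable n A : (forall i, measurable_fun setT (Z i)) ->
  history Z n A -> measurable A.
Proof.
move=> mZ; apply: smallest_sub; first exact: sigma_algebra_measurable.
by move=> _ [i _ [B mB <-]]; exact: mZ.
Qed.

End history_theory.

Section split_chain_law.
Context (R : realType) (dX : measure_display) (X : measurableType dX) (d : nat)
  (q : 'rV[nat]_d -> R.-ker X ~> X) (pi : probability X R)
  (C : set X) (eps : R) (vtheta : probability (X * 'rV[nat]_d)%type R)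
  (dO : measure_display) (Om : measurableType dO) (Pa : probability Om R)
  (J : nat -> Om -> X) (chi : nat -> Om -> bool) (V : nat -> Om -> 'rV[nat]_d).
Hypotheses (hC : measurable C) (heps : (0 < eps <= 1)%R)
  (hmin : minorization q C eps vtheta)
  (hchain : split_chain_from_atom q pi C eps vtheta Pa J chi V).

Let Z (i : nat) (w : Om) := (J i w, chi i w, walk V i w).
Let mJ n : measurable_fun setT (J n) := let: And3 h _ _ := split_measurable hchain n in h.
Let mchi n : measurable_fun setT (chi n) := let: And3 _ h _ := split_measurable hchain n in h.
Let mV n : measurable_fun setT (V n) := let: And3 _ _ h := split_measurable hchain n in h.

Lemma walkS n w : walk V n.+1 w = (walk V n w + V n.+1 w)%R.
Proof. by rewrite /walk big_ord_recr. Qed.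

Lemma measurable_walk n : measurable_fun setT (walk V n).
Proof.
elim: n => [|n IH].
  rewrite (_ : walk V 0 = cst 0%R); first exact: measurable_cst.
  by apply/funext => w; rewrite /walk big_ord0.
move=> _ B _; rewrite setTI.
rewrite (_ : _ @^-1` B = \bigcup_u (walk V n @^-1` [set u] `&` V n.+1 @^-1` [set x | B (u + x)%R])).
  apply: countable_bigcupT_measurable => // u; apply: measurableI.
    by rewrite -[_ @^-1` _]setTI; exact: IH.
  by rewrite -[_ @^-1` _]setTI; exact: mV.
apply/seteqP; split=> w /=; rewrite walkS.
  by move=> h; exists (walk V n w).
by move=> [_ _ /= [<-]].
Qed.

Let mZ i : measurable_fun setT (Z i).
Proof.
apply/measurable_fun_pairP; split; last exact: measurable_walk.
by apply/measurable_fun_pairP; split; [exact: mJ|exact: mchi].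
Qed.

Lemma history_state n i A (b : bool) : (i <= n)%N -> measurable A ->
  history Z n [set w | A (J i w) /\ chi i w = b].
Proof.
move=> ni mA.
rewrite (_ : [set w | _] = Z i @^-1` ((A `*` [set b]) `*` setT)).
  apply: history_preimage => //; apply: measurableX => //; exact: measurableX.
by apply/seteqP; split=> w /=; tauto.
Qed.

Lemma history_chi n i (b : bool) : (i <= n)%N -> history Z n [set w | chi i w = b].
Proof.
move=> /(history_state b) /(_ measurableT).
by congr history; apply/seteqP; split=> w /=; tauto.
Qed.

Lemma history_walk n i B : (i <= n)%N -> history Z n (walk V i @^-1` B).
Proof.
move=> ni; rewrite (_ : _ @^-1` B = Z i @^-1` (setT `*` B)).
  by apply: history_preimage => //; apply: measurableX.
by apply/seteqP; split=> w /=; tauto.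
Qed.

Lemma history_walk2 n i j (B : 'rV[nat]_d -> 'rV[nat]_d -> Prop) : (i <= n)%N -> (j <= n)%N ->
  history Z n [set w | B (walk V i w) (walk V j w)].
Proof.
move=> ni nj.
rewrite (_ : [set w | _] = \bigcup_u (walk V i @^-1` [set u] `&` walk V j @^-1` B u)).
  by apply: history_bigcup => // u; apply: historyI; exact: history_walk.
by apply/seteqP; split=> [w /= ?|w [_ _ [/= <-]]//]; exists (walk V i w).
Qed.

Let mhist n A : history Z n A -> measurable A := history_measurable mZ.

Definition next_step n (E : set (X * 'rV[nat]_d)) : set Om := [set w | E (J n.+1 w, V n.+1 w)].

Lemma measurable_next_step n E : measurable E -> measurable (next_step n E).
Proof.
move=> mE; rewrite -[next_step n E]setTI.
have mJV : measurable_fun setT (fun w => (J n.+1 w, V n.+1 w)).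
  by apply/measurable_fun_pairP; split; [exact: mJ|exact: mV].
exact: mJV.
Qed.

(** [c] records whether the new state lies in [C], and [b] is the mark drawn there; the value is the
    conditional probability of [b]. *)
Definition mark_weight (b c : bool) : R :=
  (if c then (if b then eps else 1 - eps) else (if b then 0 else 1))%R.

Lemma mark_weight_ge0 b c : (0 <= mark_weight b c)%R.
Proof. by rewrite /mark_weight; case: c b => -[]; have /andP[] := heps; lra. Qed.

Definition in_C (b : bool) (E : set (X * 'rV[nat]_d)) :=
  E `&` ((if b then C else ~` C) `*` setT).

Lemma measurable_in_C b E : measurable E -> measurable (in_C b E).
Proof.
move=> mE; apply: measurableI => //; apply: measurableX => //.
by case: b => //; exact: measurableC.
Qed.

(** The law of the mark depends on the new state only through membership in [C], so cutting [E]
    along [C] makes it constant on each piece and integrates [chi] out. *)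
Lemma mark_step n H E (b : bool) : history Z n H -> measurable E ->
  Pa (H `&` [set w | E (J n.+1 w, V n.+1 w) /\ chi n.+1 w = b]) =
  (mark_weight b true)%:E * Pa (H `&` next_step n (in_C true E)) +
  (mark_weight b false)%:E * Pa (H `&` next_step n (in_C false E)).
Proof.
move=> hH mE; have mH := mhist hH.
have -> : H `&` [set w | E (J n.+1 w, V n.+1 w) /\ chi n.+1 w = b] =
    (H `&` next_step n E) `&` chi n.+1 @^-1` [set b].
  by rewrite /next_step; apply/seteqP; split=> w /=; tauto.
have mHE : measurable (H `&` next_step n E).
  by apply: measurableI => //; exact: measurable_next_step.
have mCn : measurable (J n.+1 @^-1` C) by rewrite -[_ @^-1` _]setTI; exact: mJ.
rewrite (split_mark hchain) //; last first.
  apply: (@measurableI _ (g_sigma_algebraType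
    (history Z n `|` preimage_set_system setT (fun w => (J n.+1 w, V n.+1 w)) measurable))).
    by apply: sub_gen_smallest; left.
  by apply: sub_gen_smallest; right; exists E => //; rewrite setTI.
transitivity (\int[Pa]_(w in H `&` next_step n E)
   ((mark_weight b true)%:E * (\1_(J n.+1 @^-1` C) w)%:E +
    (mark_weight b false)%:E * (\1_(~` (J n.+1 @^-1` C)) w)%:E)).
  apply: eq_integral => w _.
  rewrite /bernoulli_prob fsbig_set1 /bernoulli_pmf !indicE in_setC.
  rewrite (_ : (w \in _) = (J n.+1 w \in C)); last by apply/idP/idP; rewrite !inE.
  have /andP[e0 e1] := heps.
  case: (J n.+1 w \in C) => /=.
    by rewrite mulr1 (ltW e0) e1/= mule0 adde0 mule1; case: b.
  by rewrite mulr0 lexx ler01/= mule0 add0e mule1 subr0; case: b.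
have mc (k : R) A : measurable A ->
    measurable_fun (H `&` next_step n E) (fun w => k%:E * (\1_A w)%:E).
  by move=> mA; apply: measurable_funeM; apply/measurable_EFinP; exact: measurable_indic.
rewrite ge0_integralD//; last 4 first.
- by move=> w _; apply: mule_ge0; rewrite lee_fin ?mark_weight_ge0.
- exact: mc.
- by move=> w _; apply: mule_ge0; rewrite lee_fin ?mark_weight_ge0.
- by apply: mc; exact: measurableC.
have mi A : measurable A -> measurable_fun (H `&` next_step n E) (fun w => (\1_A w)%:E).
  by move=> mA; apply/measurable_EFinP; exact: measurable_indic.
rewrite !ge0_integralZl_EFin ?mark_weight_ge0//; last 2 first.
- by apply: mi; exact: measurableC.
- exact: mi.
rewrite !integral_indic//; last exact: measurableC.
by congr (_ * Pa _ + _ * Pa _); apply/seteqP; split=> w /=; rewrite /next_step /in_C /=; tauto.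
Qed.

Let K0 x E := split_kernel q C eps vtheta (x, false) E.

Lemma measurable_kerQ E : measurable E -> measurable_fun setT (fun x => kerQ q x E).
Proof.
move=> mE; apply: emeasurable_esum => [u x|u]; first exact: measure_ge0.
apply: measurable_kernel.
rewrite (_ : [set y | _] = ysection E u); first exact: measurable_ysection.
by apply/seteqP; split=> y; rewrite /ysection /= inE.
Qed.

Lemma kerQ_ge0 x E : 0 <= kerQ q x E.
Proof. by apply: esum_ge0 => u _; exact: measure_ge0. Qed.

Lemma split_kernel_ge0 x E : measurable E -> 0 <= K0 x E.
Proof.
move=> mE; rewrite /K0 /split_kernel/=; case: ifPn => [|_]; last exact: kerQ_ge0.
rewrite inE => Cx; have /andP[e0 e1] := heps.
apply: mule_ge0; first by rewrite lee_fin invr_ge0 subr_ge0.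
by rewrite sube_ge0 ?hmin// fin_numM// fin_num_measure.
Qed.

Lemma measurable_split_kernel E : measurable E -> measurable_fun setT (K0^~ E).
Proof.
move=> mE; rewrite /K0 /split_kernel/=; apply: measurable_fun_ifT => /=.
- apply: (measurable_fun_bool true); rewrite setTI (_ : _ @^-1` _ = C)//.
  by apply/seteqP; split=> x /= h; [exact: set_mem|exact: mem_set].
- apply: measurable_funeM; apply: emeasurable_funB; first exact: measurable_kerQ.
  exact: measurable_cst.
- exact: measurable_kerQ.
Qed.

(** Joint law of state, increment and mark after one step from an unmarked state. It is a function
    of [x] alone, which lets laws of [J] be pushed through it. *)
Definition marked_kernel (b : bool) (x : X) (E : set (X * 'rV[nat]_d)) : \bar R :=
  (mark_weight b true)%:E * split_kernel q C eps vtheta (x, false) (in_C true E) +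
  (mark_weight b false)%:E * split_kernel q C eps vtheta (x, false) (in_C false E).

Lemma marked_kernel_ge0 b x E : measurable E -> 0 <= marked_kernel b x E.
Proof.
move=> mE; apply: adde_ge0; apply: mule_ge0; rewrite ?lee_fin ?mark_weight_ge0//;
  by apply: split_kernel_ge0; exact: measurable_in_C.
Qed.

Lemma measurable_marked_kernel b E : measurable E ->
  measurable_fun setT (fun x => marked_kernel b x E).
Proof.
move=> mE; apply: emeasurable_funD; apply: measurable_funeM;
  by apply: measurable_split_kernel; exact: measurable_in_C.
Qed.

Lemma marked_step n H E b : history Z n H -> (forall w, H w -> chi n w = false) ->
  measurable E ->
  Pa (H `&` [set w | E (J n.+1 w, V n.+1 w) /\ chi n.+1 w = b]) =
  \int[Pa]_(w in H) marked_kernel b (J n w) E.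
Proof.
move=> hH H0 mE; have mH := mhist hH.
rewrite mark_step//.
have step c : Pa (H `&` next_step n (in_C c E)) = \int[Pa]_(w in H) K0 (J n w) (in_C c E).
  rewrite (split_step hchain hH); last exact: measurable_in_C.
  by apply: eq_integral => w; rewrite inE => /H0; rewrite /K0 => ->.
have mK c : measurable_fun H (fun w => K0 (J n w) (in_C c E)).
  apply: measurable_funTS.
  exact: (measurableT_comp (measurable_split_kernel (measurable_in_C c mE)) (mJ n)).
have K0_ge0 c w : 0 <= K0 (J n w) (in_C c E).
  by apply: split_kernel_ge0; exact: measurable_in_C.
rewrite !step /marked_kernel ge0_integralD//; last 4 first.
- by move=> w _; apply: mule_ge0; [rewrite lee_fin mark_weight_ge0|exact: K0_ge0].
- exact: measurable_funeM (mK _).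
- by move=> w _; apply: mule_ge0; [rewrite lee_fin mark_weight_ge0|exact: K0_ge0].
- exact: measurable_funeM (mK _).
rewrite (ge0_integralZl_EFin _ mH (fun w _ => K0_ge0 true w) (mK true)) ?mark_weight_ge0//.
by rewrite (ge0_integralZl_EFin _ mH (fun w _ => K0_ge0 false w) (mK false)) ?mark_weight_ge0.
Qed.

Definition atom_step (b : bool) (E : set (X * 'rV[nat]_d)) : \bar R :=
  (mark_weight b true)%:E * vtheta (in_C true E) +
  (mark_weight b false)%:E * vtheta (in_C false E).

(** From the atom the next step has law [vtheta] whatever the state, so the past enters only through
    its probability. Regeneration rests on this factorization. *)
Lemma marked_step_atom n H E b : history Z n H -> (forall w, H w -> chi n w) ->
  measurable E ->
  Pa (H `&` [set w | E (J n.+1 w, V n.+1 w) /\ chi n.+1 w = b]) = Pa H * atom_step b E.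
Proof.
move=> hH H1 mE; have mH := mhist hH.
rewrite mark_step//.
have step c : Pa (H `&` next_step n (in_C c E)) = vtheta (in_C c E) * Pa H.
  rewrite (split_step hchain hH); last exact: measurable_in_C.
  rewrite -[RHS]integral_cst//.
  by apply: eq_integral => w; rewrite inE => /H1; rewrite /split_kernel/= => ->.
have fin c : vtheta (in_C c E) \is a fin_num by rewrite fin_num_measure//; exact: measurable_in_C.
rewrite !step /atom_step muleDr ?fin_num_measure// ?fin_num_adde_defl ?fin_numM//.
by congr (_ + _); rewrite muleA muleC.
Qed.

(** * Excursions from the atom *)

Lemma sub_vecDl (a x : 'rV[nat]_d) : sub_vec (a + x)%R a = x.
Proof. by apply/rowP => i; rewrite !mxE; exact: addKn. Qed.

Lemma walk_le m n w i : (m <= n)%N -> (walk V m w 0%R i <= walk V n w 0%R i)%N.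
Proof.
move=> /subnKC <-; elim: (n - m)%N => [|l IH]; first by rewrite addn0.
by rewrite addnS walkS mxE; apply: leq_trans IH (leq_addr _ _).
Qed.

Lemma walk_subK m n w : (m <= n)%N ->
  (walk V m w + sub_vec (walk V n w) (walk V m w))%R = walk V n w.
Proof. by move=> mn; apply/rowP => i; rewrite !mxE; apply: subnKC; exact: walk_le. Qed.

Definition avoids m l : set Om := [set w | forall i, (m < i <= m + l)%N -> chi i w = false].

Lemma history_avoids n m l : (m + l <= n)%N -> history Z n (avoids m l).
Proof.
move=> mln; rewrite (_ : avoids m l =
    ~` \bigcup_i [set w | (m < i <= m + l)%N /\ chi i w = true]).
  apply: historyC; apply: history_bigcup => // i.
  have [mi|mi] := boolP (m < i <= m + l)%N.
    rewrite (_ : [set w | _] = [set w | chi i w = true]).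
      by apply: history_chi; case/andP: mi => _ h; exact: leq_trans h mln.
    by apply/seteqP; split=> w //= [].
  rewrite (_ : [set w | _] = ~` setT); first by apply: historyC; exact: historyT.
  by rewrite setCT; apply/seteqP; split=> w //= [].
apply/seteqP; split=> w /=.
  by move=> h [i _ [/h ->]].
by move=> h i mi; apply/negbTE/negP => ci; apply: h; exists i.
Qed.

(** With [b = true] and [A = setT] this is a completed cycle of length [l + 1]; [b = false]
    describes a path still under way. The state set [A] is kept because the induction on [l] needs
    the joint law of state and displacement. *)
Definition excursion m l (b : bool) (A : set X) (B : set 'rV[nat]_d) : set Om :=
  avoids m l `&` [set w | [/\ A (J (m + l).+1 w), chi (m + l).+1 w = b &
    B (sub_vec (walk V (m + l).+1 w) (walk V m w))]].

Lemma history_excursion m l b A B : measurable A ->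
  history Z (m + l).+1 (excursion m l b A B).
Proof.
move=> mA; apply: historyI; first exact: history_avoids.
rewrite (_ : [set w | _] = [set w | A (J (m + l).+1 w) /\ chi (m + l).+1 w = b] `&`
    [set w | B (sub_vec (walk V (m + l).+1 w) (walk V m w))]).
  apply: historyI; first exact: history_state.
  by apply: (@history_walk2 _ _ _ (fun x y => B (sub_vec x y))) => //; rewrite ltnW// ltnS leq_addr.
by apply/seteqP; split=> w /=; [case|case=> -[]].
Qed.

Let atom0 : set Om := [set w | chi 0%N w = true].

Hypothesis hpiC : 0 < pi C.

Let Pa_atom0 : Pa atom0 = 1.
Proof.
have := split_init hchain measurableT.
rewrite setTI divee ?gt_eqF ?fin_num_measure// => <-.
by congr (Pa _); apply/seteqP; split=> w /=; tauto.
Qed.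

(** Induction on [l], extending the path by its last step. The displacement [u] before that step
    takes countably many values, and fixing it only translates [B]. On such a cell the law of the
    state comes from the induction hypothesis with a one-point displacement set, and
    [integral_transfer] pushes it through [marked_kernel]. *)
Lemma excursion_law l b A B m H : measurable A -> history Z m H ->
  (forall w, H w -> chi m w) ->
  Pa (H `&` excursion m l b A B) = Pa H * Pa (atom0 `&` excursion 0 l b A B).
Proof.
elim: l b A B m H => [|l IH] b A B m H mA hH H1.
  pose E := A `*` B.
  have mE : measurable E by exact: measurableX.
  have exc0 k : excursion k 0 b A B = [set w | E (J k.+1 w, V k.+1 w) /\ chi k.+1 w = b].
    rewrite /excursion /avoids addn0; apply/seteqP; split=> w /=.
      by case=> _ []; rewrite walkS sub_vecDl.
    move=> [[/= Aw Vv] cb]; split; last by rewrite walkS sub_vecDl.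
    by move=> i /andP[ki ik]; move: (leq_trans ki ik); rewrite ltnn.
  rewrite !exc0 (marked_step_atom b hH)//.
  by rewrite (@marked_step_atom 0%N atom0) ?Pa_atom0 ?mul1e//; exact: history_chi.
have mH := mhist hH.
pose f k w := pickle (sub_vec (walk V (k + l).+1 w) (walk V k w)).
have mf k n : measurable (f k @^-1` [set n]).
  apply: (@mhist (k + l).+1).
  apply: (@history_walk2 _ _ _ (fun x y => pickle (sub_vec x y) = n)) => //.
  by rewrite ltnW// ltnS leq_addr.
have mexc k b' A' B' : measurable A' -> measurable (excursion k l.+1 b' A' B').
  by move=> mA'; apply: mhist; exact: history_excursion.
rewrite (measure_partition Pa (f := f m))//; last by apply: measurableI => //; exact: mexc.
rewrite (measure_partition Pa (D := atom0 `&` _) (f := f 0%N))//; last first.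
  by apply: measurableI; [apply: mhist; exact: (history_chi true (leqnn 0))|exact: mexc].
have pH : (fine (Pa H))%:E = Pa H by rewrite fineK// fin_num_measure.
rewrite -pH -nneseriesZl; last by move=> j _; exact: measure_ge0.
apply: eq_eseriesr => j _.
case E : (@pickle_inv 'rV[nat]_d j) => [u|]; last first.
  have f0 k : f k @^-1` [set j] = set0.
    by apply/seteqP; split=> w //= fj; move: E; rewrite -fj pickleK_inv.
  by rewrite !f0 !setI0 !measure0 mule0.
have uj : pickle u = j by have := @pickle_invK 'rV[nat]_d j; rewrite E.
pose Eu := A `*` [set x | B (u + x)%R].
have mEu : measurable Eu by exact: measurableX.
have excS k : excursion k l.+1 b A B `&` f k @^-1` [set j] = excursion k l false setT [set u] `&`
    [set w | Eu (J (k + l).+2 w, V (k + l).+2 w) /\ chi (k + l).+2 w = b].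
  rewrite /excursion /avoids !addnS; apply/seteqP; split=> w /=.
    move=> [[av [Aw cb]] + fj]; rewrite walkS.
    have kl : (k <= (k + l).+1)%N by rewrite ltnW// ltnS leq_addr.
    have su : sub_vec (walk V (k + l).+1 w) (walk V k w) = u.
      by apply: (pcan_inj (@pickleK 'rV[nat]_d)); rewrite uj.
    have wk := walk_subK w kl; rewrite su in wk.
    move=> Bs; have Buv : B (u + V (k + l).+2 w)%R.
      by move: Bs; rewrite -wk -addrA sub_vecDl.
    split; last by [].
    split; first by move=> i /andP[ki ik]; apply: av; rewrite ki leqW.
    by split=> //; apply: av; rewrite leqnn ltnS leq_addr.
  move=> [[av [_ c0 su]] [[/= Aw uv] cb]].
  have wk : walk V (k + l).+1 w = (walk V k w + u)%R.
    by rewrite -su walk_subK// ltnW// ltnS leq_addr.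
  split.
    split.
      move=> i /andP[ki]; rewrite leq_eqVlt => /orP[/eqP ->//|ik].
      by apply: av; rewrite ki.
    by split=> //; rewrite walkS wk -addrA sub_vecDl.
  by rewrite -uj /f su.
rewrite -setIA excS [X in Pa X = _]setIA.
rewrite -(setIA atom0) excS [X in _ = _ * Pa X]setIA.
have hHe := historyI (history_mono (leqW (leq_addr l m)) hH)
  (@history_excursion m l false setT [set u] measurableT).
have h0e := historyI (history_mono (leq0n (0 + l).+1) (history_chi true (leqnn 0)))
  (@history_excursion 0 l false setT [set u] measurableT).
rewrite (marked_step b hHe)//; last by move=> w [_ [_ []]].
rewrite (marked_step b h0e)//; last by move=> w [_ [_ []]].
apply: (@integral_transfer _ _ _ _ _ _ _ _ _ _ _ (fun x => marked_kernel b x Eu)).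
- exact: mhist hHe.
- exact: mhist h0e.
- exact: mJ.
- exact: mJ.
- by rewrite fine_ge0.
- move=> A' mA'.
  have excA k D : (D `&` excursion k l false setT [set u]) `&` J (k + l).+1 @^-1` A' =
      D `&` excursion k l false A' [set u].
    rewrite /excursion; apply/seteqP; split=> w /=.
      by move=> [[Dw [av [_ ? ?]]] ?].
    by move=> [Dw [av [? ? ?]]].
  by rewrite !excA pH; exact: IH.
- exact: measurable_marked_kernel.
- by move=> x; exact: marked_kernel_ge0.
Qed.

(** * Recurrence of the atom *)

Hypothesis hinv : forall A, measurable A -> \int[pi]_x kerP q x A = pi A.

(** The index is shifted by one: no mark occurs at any of the times 1 to [l + 1]. *)
Let taboo l := atom0 `&` excursion 0 l false setT setT.

Let mtaboo l : measurable (taboo l).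
Proof.
by apply: measurableI; apply: mhist; [exact: history_chi|exact: history_excursion].
Qed.

Lemma taboo_start A : measurable A ->
  Pa (taboo 0 `&` J 1 @^-1` A) = atom_step false (A `*` setT).
Proof.
move=> mA; rewrite -[RHS]mul1e -[X in X * _]Pa_atom0.
rewrite -(@marked_step_atom 0%N)//; [|exact: history_chi|exact: measurableX].
congr (Pa _); rewrite /taboo /excursion /avoids; apply/seteqP; split=> w /=.
  by move=> [[c0 [_ [_ c1 _]]] Aw].
move=> [c0 [[Aw _] c1]]; split=> //; split=> //; split=> //.
by move=> i /andP[i0]; rewrite leqNgt i0.
Qed.

Lemma taboo_recursion l A : measurable A ->
  Pa (taboo l.+1 `&` J l.+2 @^-1` A) =
  \int[Pa]_(w in taboo l) marked_kernel false (J l.+1 w) (A `*` setT).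
Proof.
move=> mA; rewrite -(@marked_step l.+1 (taboo l)); first last.
- exact: measurableX.
- by move=> w [_ [_ []]].
- apply: historyI; first exact: history_chi.
  exact: (@history_excursion 0 l false setT setT measurableT).
congr (Pa _); rewrite /taboo /excursion /avoids; apply/seteqP; split=> w /=.
  move=> [[c0 [av [_ c1 _]]] Aw]; split; last by [].
  split; first exact: c0.
  split; first by move=> i /andP[i0 il]; apply: av; rewrite i0 leqW.
  by split=> //; apply: av; rewrite /= leqnn.
move=> [[c0 [av [_ c1 _]]] [[Aw _] c2]]; split=> //; split=> //; split=> //.
move=> i /andP[i0]; rewrite leq_eqVlt => /orP[/eqP ->//|il].
by apply: av; rewrite i0.
Qed.

Let mCc : measurable (~` C) := measurableC hC.
Let eps1 : (0 <= 1 - eps)%R.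
Proof. by have /andP[_] := heps; lra. Qed.
(** Invariant law of the split chain off the atom, projected to the states: a point of [C] has mark
    0 with probability [1 - eps]. *)
Let pi0 : measure X R := measure_add (mrestr pi mCc) (mscale (NngNum eps1) (mrestr pi hC)).

Let integral_pi0 f : measurable_fun setT f -> (forall x, 0 <= f x) ->
  \int[pi0]_x f x = \int[pi]_(x in ~` C) f x + (1 - eps)%:E * \int[pi]_(x in C) f x.
Proof.
move=> mf f0; rewrite ge0_integral_measure_add// ge0_integral_mscale//.
by rewrite !ge0_integral_mrestr.
Qed.

Lemma split_kernel_le x B : measurable B -> C x ->
  (1 - eps)%:E * K0 x (B `*` setT) + eps%:E * vtheta (B `*` setT) <= kerQ q x (B `*` setT).
Proof.
move=> mB Cx; rewrite /K0 /split_kernel/= mem_set//.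
have mBT : measurable (B `*` @setT 'rV[nat]_d) by exact: measurableX.
have fv : eps%:E * vtheta (B `*` setT) \is a fin_num by rewrite fin_numM// fin_num_measure.
(* At [eps = 1] the residual kernel is a junk value, but it is multiplied by 0 and the claim is the
   minorization itself; otherwise the two sides are equal. *)
have [e1|e1] := eqVneq eps 1%R.
  by rewrite {1}e1 subrr mul0e add0e; exact: hmin.
rewrite muleA -EFinM mulfV ?subr_eq0 1?eq_sym// mul1e.
by rewrite subeK.
Qed.

Lemma kerQ_rectangle x B : kerQ q x (B `*` setT) = kerP q x B.
Proof.
rewrite /kerQ /kerP; apply: eq_esum => u _; congr (q u x _).
by apply/seteqP; split=> y /=; tauto.
Qed.

Let mrect (B : set X) : measurable B -> measurable (B `*` @setT 'rV[nat]_d).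
Proof. by move=> mB; exact: measurableX. Qed.

(* pi0 + eps pi(C) delta_atom is invariant for the split chain, here in the
   form of an inequality for the part off the atom. *)
Lemma split_invariant_le B : measurable B ->
  \int[pi0]_x K0 x (B `*` setT) + eps%:E * pi C * vtheta (B `*` setT) <= pi B.
Proof.
move=> mB; have mBT := mrect mB.
have mK := measurable_split_kernel mBT.
have K0_ge0 x : 0 <= K0 x (B `*` setT) by exact: split_kernel_ge0.
have mQ := measurable_kerQ mBT.
have /andP[e0 _] := heps.
rewrite integral_pi0// -(hinv mB).
under [leRHS]eq_integral do rewrite -kerQ_rectangle.
rewrite -[in leRHS](setvU C) ge0_integral_setU//; last 3 first.
- by rewrite setvU.
- by move=> x _; exact: kerQ_ge0.
- by apply/disj_setPS; rewrite setICl.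
rewrite -addeA leeD//.
  apply: ge0_le_integral => //.
  - exact: measurable_funTS.
  - exact: measurable_funTS.
  - by move=> x nCx; rewrite /K0 /split_kernel/= memNset.
(* The contribution of the atom is written as an integral of a constant over [C], so that together
   with [(1 - eps) K0] it can be compared pointwise with the unsplit kernel. *)
have -> : eps%:E * pi C * vtheta (B `*` setT) =
    \int[pi]_(x in C) cst (eps%:E * vtheta (B `*` setT)) x.
  by rewrite integral_cst// muleAC.
rewrite -ge0_integralZl_EFin//; last exact: measurable_funTS.
rewrite -ge0_integralD//; last 3 first.
- by move=> x _; rewrite mule_ge0.
- by apply: measurable_funeM; exact: measurable_funTS.
- by move=> x _; rewrite /= mule_ge0// lee_fin ltW.
apply: ge0_le_integral => //.
- by move=> x _; rewrite adde_ge0// mule_ge0// lee_fin ltW.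
- apply: emeasurable_funD; last exact: measurable_cst.
  by apply: measurable_funeM; exact: measurable_funTS.
- exact: measurable_funTS.
- by move=> x Cx; exact: split_kernel_le.
Qed.

(** The partial occupation sums obey a recursion: the mass just leaving the atom, plus the previous
    sum pushed one step. The previous sum is below [pi0] by induction, and [split_invariant_le]
    brings the result below [pi0] again. The weight [eps * pi C] is the invariant mass of the
    atom. *)
Lemma taboo_sum_le n A : measurable A ->
  (eps * fine (pi C))%:E * \sum_(l < n) Pa (taboo l `&` J l.+1 @^-1` A) <= pi0 A.
Proof.
have /andP[e0 _] := heps.
have c0 : (0 <= eps * fine (pi C))%R by rewrite mulr_ge0 ?fine_ge0// ltW.
elim: n A => [|n IH] A mA; first by rewrite big_ord0 mule0.
have mAT := mrect mA.
rewrite big_ord_recl ge0_muleDr//; last by apply: sume_ge0.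
have -> : \sum_(i < n) Pa (taboo (lift ord0 i) `&` J (lift ord0 i).+1 @^-1` A) =
    \sum_(i < n) \int[Pa]_(w in taboo i) marked_kernel false (J i.+1 w) (A `*` setT).
  by apply: eq_bigr => i _; rewrite taboo_recursion.
apply: le_trans (leeD2l _ (sum_integral_le (m := pi0) mtaboo (fun l => mJ l.+1) c0 IH
  (measurable_marked_kernel false mAT) (fun x => marked_kernel_ge0 false x mAT))) _.
rewrite taboo_start//.
have mAC : measurable (A `&` C) by exact: measurableI.
have mAnC : measurable (A `&` ~` C) by apply: measurableI => //; exact: measurableC.
have inT : in_C true (A `*` setT) = (A `&` C) `*` setT.
  by rewrite /in_C; apply/seteqP; split=> -[x u] /=; tauto.
have inF : in_C false (A `*` setT) = (A `&` ~` C) `*` setT.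
  by rewrite /in_C; apply/seteqP; split=> -[x u] /=; tauto.
have K0_ge0 B x : measurable B -> 0 <= K0 x (B `*` setT).
  by move=> mB; apply: split_kernel_ge0; exact: mrect.
have mK B (mB : measurable B) := measurable_split_kernel (mrect mB).
have mkE x : marked_kernel false x (A `*` setT) =
    (1 - eps)%:E * K0 x ((A `&` C) `*` setT) + K0 x ((A `&` ~` C) `*` setT).
  by rewrite /marked_kernel inT inF /mark_weight mul1e.
under eq_integral do rewrite mkE.
rewrite ge0_integralD//; last 4 first.
- by move=> x _; apply: mule_ge0; [|exact: K0_ge0].
- by apply: measurable_funeM; exact: mK.
- by move=> x _; exact: K0_ge0.
- exact: mK.
rewrite ge0_integralZl_EFin//; last 2 first.
- by move=> x _; exact: K0_ge0.
- exact: mK.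
have -> : pi0 A = (1 - eps)%:E * pi (A `&` C) + pi (A `&` ~` C).
  by rewrite /= /measure_add /msum/= !big_ord_recl big_ord0 adde0 /= /mscale/= /mrestr/= addeC.
have fpi B : measurable B -> pi B \is a fin_num by exact: fin_num_measure.
have fv B : measurable B -> vtheta (B `*` setT) \is a fin_num.
  by move=> mB; exact: fin_num_measure (mrect mB).
(* Invariance is applied separately to the parts of [A] inside and outside [C], since only a
   fraction [1 - eps] of the former stays unmarked. *)
have bound B : measurable B -> exists x v p : R, [/\ \int[pi0]_x K0 x (B `*` setT) = x%:E,
    vtheta (B `*` setT) = v%:E, pi B = p%:E & (x + eps * fine (pi C) * v <= p)%R].
  move=> mB; have := split_invariant_le mB.
  have : 0 <= \int[pi0]_x K0 x (B `*` setT) by apply: integral_ge0 => x _; exact: K0_ge0.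
  rewrite -(fineK (fpi B mB)) -(fineK (fpi C hC)) -(fineK (fv B mB)) -!EFinM.
  case: (\int[pi0]_x _) => [x| |]// _; rewrite -EFinD lee_fin => h.
  by exists x, (fine (vtheta (B `*` setT))), (fine (pi B)).
have [x1 [v1 [p1 [-> v1E -> b1]]]] := bound _ mAC.
have [x2 [v2 [p2 [-> v2E -> b2]]]] := bound _ mAnC.
rewrite /atom_step inT inF v1E v2E /mark_weight mul1e -!(EFinM, EFinD) lee_fin.
have := ler_wpM2l eps1 b1; lra.
Qed.

Definition next_cycle m (B : set 'rV[nat]_d) : set Om := \bigcup_l excursion m l true setT B.

Lemma atom_recurrent : Pa (atom0 `&` next_cycle 0 setT) = 1.
Proof.
pose F := atom0 `&` ~` next_cycle 0 setT.
have mA0 : measurable atom0 by apply: mhist; exact: (history_chi true (leqnn 0)).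
have mN : measurable (next_cycle 0 setT).
  by apply: bigcup_measurable => l _; apply: mhist; exact: history_excursion.
have mF : measurable F by apply: measurableI => //; exact: measurableC.
have Ftaboo l : F `<=` taboo l.
  move=> w [c0 nw]; split=> //.
  have ci i : (0 < i)%N -> chi i w = false.
    elim/ltn_ind: i => -[//|i] IH _; apply/negbTE/negP => ci; apply: nw.
    exists i => //; split; last by [].
    by move=> k /andP[k0 ki]; apply: IH.
  by split; [move=> i /andP[i0 _]; exact: ci|split=> //; exact: ci].
suff F0 : Pa F = 0.
  have U : Pa (atom0 `&` next_cycle 0 setT `|` F) = Pa (atom0 `&` next_cycle 0 setT) + Pa F.
    apply: measureU => //; first exact: measurableI.
    by apply/seteqP; split=> // w [[_ ?] [_ ?]].
  by rewrite -Pa_atom0 -[Pa (_ `&` _)]adde0 -F0 -U -setIUr setUv setIT.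
have piC0 : (0 < fine (pi C))%R.
  by rewrite fine_gt0// hpiC/= ltey_eq fin_num_measure.
have /andP[e0 _] := heps.
pose c := (eps * fine (pi C))%R.
have c0 : (0 < c)%R by exact: mulr_gt0.
have pF : (fine (Pa F))%:E = Pa F by rewrite fineK// fin_num_measure.
have p0 : (0 <= fine (Pa F))%R by exact: fine_ge0.
(* [F], the event of no return, lies in every [taboo l], so [n] copies of it, weighted by [c], fit
   under the mass of [pi0], which is at most 2. This for all [n] forces [Pa F = 0]. *)
have bnd n : (c * (n%:R * fine (Pa F)) <= 1 + 1)%R.
  rewrite -lee_fin EFinM (EFinM n%:R) pF.
  have -> : n%:R%:E * Pa F = \sum_(l < n) Pa F.
    by rewrite sumr_const card_ord mule_natl.
  have pi01 : pi0 setT <= (1 + 1)%:E.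
    rewrite /= /measure_add /msum/= !big_ord_recl big_ord0 adde0 /= /mscale/= /mrestr/=.
    rewrite !setTI [leRHS]EFinD; apply: leeD; first exact: probability_le1.
    rewrite -[leRHS]mule1; apply: lee_pmul => //; last exact: probability_le1.
    by rewrite lee_fin; lra.
  apply: le_trans pi01; apply: le_trans (taboo_sum_le n measurableT).
  rewrite lee_wpmul2l//; first by rewrite lee_fin ltW.
  apply: lee_sum => l _; rewrite preimage_setT setIT.
  by apply: le_measure; rewrite ?inE.
apply/eqP; rewrite -pF eqe; apply/negPn/negP => F0.
have Fgt : (0 < c * fine (Pa F))%R by rewrite mulr_gt0// lt0r F0.
have := bnd (Num.truncn (2 / (c * fine (Pa F)))).+1.
apply/negP; rewrite -ltNge mulrCA -ltr_pdivrMr//.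
have := truncnS_gt (2 / (c * fine (Pa F)))%R.
by rewrite -natr1; lra.
Qed.

(** * Cycles *)

Lemma nat_infP (A : set nat) n : nat_inf A = Some n <-> A n /\ forall i, (i < n)%N -> ~ A i.
Proof.
rewrite /nat_inf; case: pselect => [h|nA]; last first.
  by split=> // -[An _]; case: nA; exists n; exact/asboolP.
case: ex_minnP => m /asboolP Am mmin; split.
  move=> [<-]; split=> // i im Ai; have := mmin i (asboolT Ai).
  by rewrite leqNgt im.
move=> [An nmin]; congr Some; apply/eqP; rewrite eqn_leq (mmin n (asboolT An))/=.
by rewrite leqNgt; apply/negP => /nmin.
Qed.

(** [split_space] makes membership in [C] automatic at marked times, so visits to the atom are read
    from [chi] alone, in the terms used by [avoids]. *)
Lemma atom_timeS_Some j w n : atom_time C J chi j.+1 w = Some n <->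
  exists m, [/\ atom_time C J chi j w = Some m, (m < n)%N, chi n w = true &
    forall i, (m < i < n)%N -> chi i w = false].
Proof.
rewrite /atom_time /=; set T := visit_time _ j.
case: T => [m|]; last by split=> // -[m []].
rewrite nat_infP /=; split.
  move=> [[mn [Cn cn]] nmin]; exists m; split=> // i /andP[mi ni].
  apply/negbTE/negP => ci; apply: (nmin i ni); split=> //.
  by split=> //; exact: split_space hchain _ _ ci.
move=> [_ [[<-] mn cn av]]; split.
  by split=> //; split=> //; exact: split_space hchain _ _ cn.
by move=> i ni [mi [_]]; rewrite av ?mi.
Qed.

Lemma history_atom_time j n : history Z n [set w | atom_time C J chi j w = Some n].
Proof.
elim: j n => [|j IH] n.
  case: n => [|n].
    rewrite (_ : [set w | _] = setT); first exact: historyT.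
    by apply/seteqP; split.
  rewrite (_ : [set w | _] = ~` setT); first by apply: historyC; exact: historyT.
  by rewrite setCT; apply/seteqP; split.
(* [avoids m (n.-1 - m)] covers exactly the times strictly between [m] and [n]. *)
rewrite (_ : [set w | _] = \bigcup_m ([set w | (m < n)%N /\ atom_time C J chi j w = Some m] `&`
    (avoids m (n.-1 - m)%N `&` [set w | chi n w = true]))); last first.
  apply/seteqP; split=> w /=.
    move=> /atom_timeS_Some[m [Tm mn cn av]]; exists m => //; split=> //; split=> //.
    move=> i /andP[mi]; rewrite subnKC; last by rewrite -ltnS (ltn_predK mn).
    by move=> ni; apply: av; rewrite mi -(ltn_predK mn) ltnS.
  move=> [m _ [[mn Tm] [av cn]]]; apply/atom_timeS_Some; exists m; split=> // i /andP[mi ni].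
  apply: av; rewrite mi subnKC; last by rewrite -ltnS (ltn_predK mn).
  by rewrite -ltnS (ltn_predK mn).
apply: history_bigcup => // m; have [mn|nm] := ltnP m n; last first.
  rewrite (_ : _ `&` _ = ~` setT); first by apply: historyC; exact: historyT.
  by rewrite setCT; apply/seteqP; split=> w // [[]].
apply: historyI; last apply: historyI.
- rewrite (_ : [set w | _] = [set w | atom_time C J chi j w = Some m]).
    exact: history_mono (ltnW mn) (IH m).
  by apply/seteqP; split=> w // [].
- by apply: history_avoids; rewrite subnKC ?leq_pred// -ltnS (ltn_predK mn).
- exact: history_chi.
Qed.

Lemma atom_time_chi j w n : chi 0%N w = true -> atom_time C J chi j w = Some n -> chi n w = true.
Proof. by case: j => [c0 [<-]//|j _ /atom_timeS_Some[m []]]. Qed.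

Lemma cycle_sumS j w : cycle_sum C J chi V j.+1 w =
  (cycle_sum C J chi V j w + Defs.cycle C J chi V j.+1 w)%R.
Proof. by rewrite /cycle_sum big_nat_recr. Qed.

Lemma cycle_sum_walk j w n : atom_time C J chi j w = Some n ->
  cycle_sum C J chi V j w = walk V n w.
Proof.
elim: j n => [|j IH] n.
  by move=> [<-]; rewrite /cycle_sum /walk big_geq// big_ord0.
move=> Tn; have /atom_timeS_Some[m [Tm mn _ _]] := Tn.
by rewrite cycle_sumS (IH _ Tm) /Defs.cycle /= Tm Tn walk_subK// ltnW.
Qed.

(** Finiteness of the next time has to be recorded: where it fails, [cycle] has the default value 0,
    which may well belong to [B]. *)
Lemma next_cycleE m j B w : atom_time C J chi j w = Some m ->
  next_cycle m B w <-> atom_time C J chi j.+1 w <> None /\ B (Defs.cycle C J chi V j.+1 w).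
Proof.
move=> Tm; split.
  move=> [l _ [av [_ cl Bl]]].
  have Tl : atom_time C J chi j.+1 w = Some (m + l).+1.
    apply/atom_timeS_Some; exists m; split=> //; first by rewrite ltnS leq_addr.
  by rewrite /Defs.cycle /= Tm Tl.
case E : (atom_time C J chi j.+1 w) => [n|]; last by case.
move=> [_]; rewrite /Defs.cycle /= Tm E => Bn.
have /atom_timeS_Some[m' [+ mn cn av]] := E.
rewrite Tm => -[?]; subst m'.
have nE : (m + (n.-1 - m)).+1 = n.
  by rewrite subnKC ?(ltn_predK mn)// -ltnS (ltn_predK mn).
exists (n.-1 - m)%N => //; split; last by rewrite /= nE.
by move=> i /andP[mi]; rewrite -ltnS nE => ni; apply: av; rewrite mi.
Qed.

(** Sum of [excursion_law] over the lengths; different lengths are disjoint because the shorter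
    excursion ends with a mark at a time that the longer one avoids. *)
Lemma next_cycle_law m H B : history Z m H -> (forall w, H w -> chi m w) ->
  Pa (H `&` next_cycle m B) = Pa H * Pa (atom0 `&` next_cycle 0 B).
Proof.
move=> hH H1; have mH := mhist hH.
have decomp D k : measurable D -> Pa (D `&` next_cycle k B) =
    \sum_(l <oo) Pa (D `&` excursion k l true setT B).
  move=> mD; rewrite /next_cycle setI_bigcupr measure_semi_bigcup//.
  - move=> l; apply: measurableI => //; apply: mhist; exact: history_excursion.
  - apply/trivIsetP => i j _ _; rewrite neq_lt => ij; apply/seteqP; split=> // w.
    move=> [[_ [avi [_ ci _]]] [_ [avj [_ cj _]]]].
    case/orP: ij => ij.
      by move: ci; rewrite avj// ltnS leq_addr/= -addnS leq_add2l.
    by move: cj; rewrite avi// ltnS leq_addr/= -addnS leq_add2l.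
  - apply: bigcup_measurable => l _; apply: measurableI => //; apply: mhist.
    exact: history_excursion.
have pH : (fine (Pa H))%:E = Pa H by rewrite fineK// fin_num_measure.
rewrite !decomp//; last by apply: mhist; exact: (history_chi true (leqnn 0)).
rewrite -[in RHS]pH -nneseriesZl; last by move=> l _; exact: measure_ge0.
by apply: eq_eseriesr => l _; rewrite pH; exact: excursion_law.
Qed.

Let T := atom_time C J chi.
Let Y := Defs.cycle C J chi V.
Let S := cycle_sum C J chi V.

Lemma measurable_atom_time j o : measurable [set w | T j w = o].
Proof.
case: o => [n|]; first by apply: (@mhist n); exact: history_atom_time.
rewrite (_ : [set w | _] = ~` \bigcup_n [set w | T j w = Some n]).
  apply: measurableC; apply: bigcup_measurable => n _.
  by apply: (@mhist n); exact: history_atom_time.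
apply/seteqP; split=> w /=; first by move=> TN [n _]; rewrite /= TN.
by case E : (T j w) => [n|]// h; case: h; exists n.
Qed.

Lemma measurable_cstP (Q : Prop) : measurable [set _ : Om | Q].
Proof.
by have [q0|q0] := pselect Q; [rewrite (_ : [set _ | _] = setT)|
  rewrite (_ : [set _ | _] = set0)]; rewrite //; apply/seteqP; split.
Qed.

Lemma measurable_cases (I : Type) (f : Om -> I) (P : I -> set Om) : countable [set: I] ->
  (forall i, measurable [set w | f w = i]) -> (forall i, measurable (P i)) ->
  measurable [set w | P (f w) w].
Proof.
move=> cI mf mP; rewrite (_ : [set w | _] = \bigcup_i ([set w | f w = i] `&` P i)).
  by apply: countable_bigcupT_measurable => // i; exact: measurableI.
by apply/seteqP; split=> [w /= ?|w [i _ [/= <-]]//]; exists (f w).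
Qed.

Lemma measurable_cycle j B : measurable (Y j @^-1` B).
Proof.
pose P (o1 o2 : option nat) : set Om := [set w | B (match o1, o2 with
  | Some m, Some n => sub_vec (walk V n w) (walk V m w) | _, _ => 0%R end)].
apply: (@measurable_cases _ (T j.-1) (fun o1 => [set w | P o1 (T j w) w])) => //.
  exact: measurable_atom_time.
move=> o1; apply: (@measurable_cases _ (T j) (P o1)) => //; first exact: measurable_atom_time.
move=> o2; case: o1 o2 => [m|] [n|]; rewrite /P.
- apply: (@mhist (maxn n m)).
  by apply: (@history_walk2 _ _ _ (fun x y => B (sub_vec x y))); rewrite ?leq_maxl ?leq_maxr.
all: exact: measurable_cstP.
Qed.

Lemma measurable_cycle_sum j B : measurable (S j @^-1` B).
Proof.
elim: j B => [|j IH] B.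
  rewrite (_ : _ @^-1` B = cst 0%R @^-1` B).
    by rewrite -[_ @^-1` _]setTI; exact: measurable_cst.
  by apply/seteqP; split=> w; rewrite /S /cycle_sum/= big_geq.
rewrite (_ : _ @^-1` B = [set w | B (S j w + Y j.+1 w)%R]).
  apply: (@measurable_cases _ (S j) (fun u => [set w | B (u + Y j.+1 w)%R])) => //.
    by move=> u; exact: (IH [set u]).
  by move=> u; exact: (measurable_cycle j.+1 (fun x => B (u + x)%R)).
by apply/seteqP; split=> w /=; rewrite /S cycle_sumS.
Qed.

Lemma probability1_setI A B : measurable A -> measurable B -> Pa B = 1 -> Pa (A `&` B) = Pa A.
Proof.
move=> mA mB B1; have nB0 : Pa (~` B) = 0 by rewrite probability_setC// B1 subee.
have : Pa A = Pa (A `&` B) + Pa (A `&` ~` B).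
  rewrite -measureU.
  - by rewrite -setIUr setUv setIT.
  - exact: measurableI.
  - by apply: measurableI => //; exact: measurableC.
  - by apply/seteqP; split=> // w [[_ ?] [_ ?]].
have : Pa (A `&` ~` B) = 0.
  apply: subset_measure0 nB0 => //.
  - by apply: measurableI => //; exact: measurableC.
  - exact: measurableC.
by move=> -> ->; rewrite adde0.
Qed.

Let mA0 : measurable atom0 := mhist (history_chi true (leqnn 0)).

Let hist_atom_time j m : history Z m (atom0 `&` [set w | T j w = Some m]).
Proof.
apply: historyI; last exact: history_atom_time.
by apply: (@history_mono _ _ _ _ _ 0) => //; exact: history_chi.
Qed.

Let atom_time_fin j := [set w | T j w <> None].

Let matom_time_fin j : measurable (atom_time_fin j).
Proof. exact: measurableC (measurable_atom_time j None). Qed.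

(** On each event T_j = m the chain regenerates at [m] and returns almost surely. [atom0] is carried
    along because the initial mark is 1 only almost surely, and without it the time T_0 = 0 need not
    be a visit to the atom. *)
Lemma atom_time_finite j : Pa (atom0 `&` atom_time_fin j) = 1.
Proof.
elim: j => [|j IH]; first by rewrite (_ : _ `&` _ = atom0)//; apply/seteqP; split=> [w []|].
pose f w := pickle (T j w).
have mf n : measurable (f @^-1` [set n]).
  apply: (@measurable_cases _ (T j) (fun o => [set _ | pickle o = n])) => //.
    exact: measurable_atom_time.
  by move=> o; exact: measurable_cstP.
have mfin k : measurable (atom0 `&` atom_time_fin k) by exact: measurableI.
rewrite -IH (measure_partition _ (mfin j.+1) mf) (measure_partition _ (mfin j) mf).
apply: eq_eseriesr => n _; case E : (@pickle_inv (option nat) n) => [t|]; last first.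
  have -> : f @^-1` [set n] = set0.
    by apply/seteqP; split=> w //= fj; move: E; rewrite -fj pickleK_inv.
  by rewrite !setI0.
have fE : f @^-1` [set n] = [set w | T j w = t].
  have tn : pickle t = n by have := @pickle_invK (option nat) n; rewrite E.
  apply/seteqP; split=> w /=; last by rewrite /f => ->.
  by rewrite -tn => /(pcan_inj (@pickleK (option nat))).
rewrite fE; case: t {E fE} => [m|]; last first.
  congr (Pa _); apply/seteqP; split=> w /=; last by move=> [[_]].
  move=> [[_ Tj1] Tj]; case: Tj1; rewrite /T /atom_time /=.
  by move: Tj; rewrite /T /atom_time => ->.
have -> : atom0 `&` atom_time_fin j.+1 `&` [set w | T j w = Some m] =
    (atom0 `&` [set w | T j w = Some m]) `&` next_cycle m setT.
  apply/seteqP; split=> w /=.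
    by move=> [[c0 Tj1] Tj]; split=> //; apply/(next_cycleE _ Tj).
  by move=> [[c0 Tj] /(next_cycleE _ Tj)[]].
transitivity (Pa (atom0 `&` [set w | T j w = Some m]) * Pa (atom0 `&` next_cycle 0 setT)).
  by apply: next_cycle_law => // w [c0 Tj]; exact: atom_time_chi c0 Tj.
rewrite atom_recurrent mule1; congr (Pa _); apply/seteqP; split=> w /=.
  by move=> [c0 Tj]; rewrite /atom_time_fin/= Tj.
by move=> [[c0 _] Tj].
Qed.

(** Strong Markov property at T_j, reduced to a fixed time. Replacing the cycle event by
    [next_cycle] costs only the null set where the initial mark is missing or the next time is
    infinite. *)
Lemma cycle_indep j m D B : history Z m D -> D `<=` [set w | T j w = Some m] ->
  Pa (D `&` Y j.+1 @^-1` B) = Pa D * Pa (Y 1%N @^-1` B).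
Proof.
move=> hD DT; have mD := mhist hD.
have law k (E : set Om) i : measurable E -> E `<=` [set w | T i w = Some k] ->
    Pa (E `&` Y i.+1 @^-1` B) = Pa ((E `&` atom0) `&` next_cycle k B).
  move=> mE ET; rewrite -(probability1_setI _ _ (atom_time_finite i.+1)); last 2 first.
  - by apply: measurableI => //; exact: measurable_cycle.
  - exact: measurableI.
  congr (Pa _); apply/seteqP; split=> w /=.
    by move=> [[Ew Yw] [c0 Ti]]; split=> //; apply/(next_cycleE _ (ET _ Ew)).
  by move=> [[Ew c0] /(next_cycleE _ (ET _ Ew))[Ti Yw]].
rewrite (law m D j)//.
have -> : Pa (Y 1%N @^-1` B) = Pa (atom0 `&` next_cycle 0 B).
  by rewrite -[_ @^-1` _]setTI (@law 0%N setT 0%N)// setTI.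
rewrite (@next_cycle_law m (D `&` atom0)).
- by rewrite (probability1_setI mD mA0 Pa_atom0).
- apply: historyI => //; apply: (@history_mono _ _ _ _ _ 0) => //; exact: history_chi.
- by move=> w [/DT Tj c0]; exact: atom_time_chi c0 Tj.
Qed.

Lemma ge0_integral_partition (f : Om -> nat) (g : Om -> \bar R) :
  (forall n, measurable (f @^-1` [set n])) -> measurable_fun setT g -> (forall w, 0 <= g w) ->
  \int[Pa]_w g w = \sum_(n <oo) \int[Pa]_(w in f @^-1` [set n]) g w.
Proof.
move=> mf mg g0.
have UT : \bigcup_n f @^-1` [set n] = setT by apply/seteqP; split=> // w _; exists (f w).
rewrite -UT ge0_integral_bigcup//; first by rewrite UT.
apply/trivIsetP => i k _ _ ik; apply/seteqP; split=> // w [/= fi fk].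
by move: ik; rewrite -fi -fk eqxx.
Qed.

(** Partition by the countable pair (T_j, S_j). On a cell with T_j finite the exponential of [S j]
    is constant and [cycle_indep] separates the next cycle; the cells with T_j infinite are null. *)
Lemma cycle_sum_moment theta (M : R) :
  \int[Pa]_w (expR (dotr theta (real_vec R (Y 1%N w))))%:E = M%:E ->
  forall j, \int[Pa]_w (expR (dotr theta (real_vec R (S j w))))%:E = (M ^+ j)%:E.
Proof.
pose e (z : 'rV[nat]_d) : \bar R := (expR (dotr theta (real_vec R z)))%:E.
have e0 z : 0 <= e z by rewrite lee_fin expR_ge0.
move=> Y1M; elim=> [|j IH].
  under eq_integral => w _.
    rewrite (_ : S 0 w = 0%R); last by rewrite /S /cycle_sum big_geq.
    rewrite (_ : dotr _ _ = 0%R) ?expR0; last first.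
      by rewrite /dotr big1// => i _; rewrite !mxE mulr0.
    over.
  by rewrite integral_cst// mul1e; exact: probability_setT.
have mY k : measurable_fun setT (fun w => e (Y k w)).
  by move=> _ B _; rewrite setTI; exact: (measurable_cycle k (e @^-1` B)).
have mS k : measurable_fun setT (fun w => e (S k w)).
  by move=> _ B _; rewrite setTI; exact: (measurable_cycle_sum k (e @^-1` B)).
pose f w := pickle (T j w, S j w).
have mf n : measurable (f @^-1` [set n]).
  apply: (@measurable_cases _ (T j) (fun t => [set w | pickle (t, S j w) = n])) => //.
    exact: measurable_atom_time.
  by move=> t; exact: (measurable_cycle_sum j (fun c => pickle (t, c) = n)).
transitivity (\int[Pa]_w (e (S j w) * e (Y j.+1 w))).
  by apply: eq_integral => w _; rewrite /e /S cycle_sumS dotrDr expRD EFinM.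
rewrite exprS EFinM -IH.
rewrite (ge0_integral_partition mf)//; last 2 first.
- exact: emeasurable_funM.
- by move=> w; exact: mule_ge0.
rewrite (ge0_integral_partition mf (mS j))//.
rewrite -nneseriesZl; last by move=> n _; exact: integral_ge0.
apply: eq_eseriesr => n _.
case E : (@pickle_inv (option nat * 'rV[nat]_d)%type n) => [[t c]|]; last first.
  have -> : f @^-1` [set n] = set0.
    by apply/seteqP; split=> w //= fj; move: E; rewrite -fj pickleK_inv.
  by rewrite !integral_set0 mule0.
have fE : f @^-1` [set n] = [set w | T j w = t /\ S j w = c].
  have tn : pickle (t, c) = n by have := @pickle_invK (option nat * 'rV[nat]_d)%type n; rewrite E.
  apply/seteqP; split=> w /=; last by rewrite /f => -[-> ->].
  by rewrite -tn => /(pcan_inj (@pickleK (option nat * 'rV[nat]_d)%type)) -[].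
rewrite fE; have mD : measurable [set w | T j w = t /\ S j w = c] by rewrite -fE.
case: t {E} fE mD => [m|] fE mD; last first.
  have N0 : Pa (~` (atom0 `&` atom_time_fin j)) = 0.
    rewrite probability_setC; last exact: measurableI.
    by rewrite atom_time_finite subee.
  have D0 : Pa [set w | T j w = None /\ S j w = c] = 0.
    apply: (@subset_measure0 _ _ _ _ _ (~` (atom0 `&` atom_time_fin j))) => //.
    - by apply: measurableC; exact: measurableI.
    - by move=> w [Tj _] [_].
  rewrite !null_set_integral ?mule0//; apply: measurable_funTS => //.
  exact: emeasurable_funM.
set D := [set w | _] in mD *.
(* [S j] involves all earlier atom times, but on T_j = m it telescopes to [walk V m], which is
   observable at time [m]. *)
have hD : history Z m D.
  rewrite (_ : D = [set w | T j w = Some m] `&` walk V m @^-1` [set c]).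
    by apply: historyI; [exact: history_atom_time|exact: history_walk].
  apply/seteqP; split=> w /= [Tj Sj]; split=> //=.
    by rewrite -(cycle_sum_walk Tj).
  by rewrite /S (cycle_sum_walk Tj).
have pD : (fine (Pa D))%:E = Pa D by rewrite fineK// fin_num_measure.
have SD w : w \in D -> e (S j w) = e c by rewrite inE => -[_ ->].
transitivity (\int[Pa]_(w in D) (e c * e (Y j.+1 w))).
  by apply: eq_integral => w /SD ->.
rewrite [in RHS](eq_integral (cst (e c)) _ SD) integral_cst//.
rewrite ge0_integralZl_EFin ?expR_ge0//; last exact: measurable_funTS.
have meas_e : @measurable_fun _ _ 'rV[nat]_d (\bar R) setT e by [].
rewrite (@integral_transfer _ _ _ _ _ Pa (Y j.+1) (Y 1%N) D setT (fine (Pa D)) e)//.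
- by rewrite Y1M pD [RHS]muleC -muleA.
- by move=> _ B _; rewrite setTI; exact: measurable_cycle.
- by move=> _ B _; rewrite setTI; exact: measurable_cycle.
- by rewrite fine_ge0.
- by move=> A _; rewrite setTI pD; apply: cycle_indep hD _ => w [].
Qed.

End split_chain_law.

(** * Large deviations of the renewal counts *)

Section limits.
Context (R : realType) (T : choiceType) (X : filteredType T) (F : set_system X).
Implicit Types (f : X -> \bar R) (l : \bar R).

Lemma limf_einf_ge f l : (\forall x \near F, l <= f x) -> l <= limf_einf f F.
Proof.
move=> h; rewrite limf_einfE; apply: ereal_sup_ge; exists (ereal_inf (f @` [set x | l <= f x])).
  by exists [set x | l <= f x].
by apply: le_ereal_inf_tmp => _ [x /= lx <-].
Qed.

Lemma limf_esup_le f l : (\forall x \near F, f x <= l) -> limf_esup f F <= l.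
Proof.
move=> h; rewrite limf_esupE; apply: ereal_inf_le; exists (ereal_sup (f @` [set x | f x <= l])).
  by exists [set x | f x <= l].
by apply: ge_ereal_sup => _ [x /= lx <-].
Qed.

Lemma limf_einf_gt f (FF : Filter F) l : l < limf_einf f F -> \forall x \near F, l < f x.
Proof.
rewrite limf_einfE => /ereal_sup_gt[_ [A FA <-] lA].
by apply: filterS FA => x Ax; apply: (lt_le_trans lA); apply: ereal_inf_lbound; exists x.
Qed.

Lemma limf_esup_lt f (FF : Filter F) l : limf_esup f F < l -> \forall x \near F, f x < l.
Proof.
rewrite limf_esupE => /ereal_inf_lt[_ [A FA <-] lA].
by apply: filterS FA => x Ax; apply: le_lt_trans lA; apply: ereal_sup_ubound; exists x.
Qed.

Lemma cvg_limf f (FF : Filter F) l :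
  l <= limf_einf f F -> limf_esup f F <= l -> f x @[x --> F] --> l.
Proof.
move=> li ls; case: l li ls => [r| |] li ls.
- have hi (e : R) : (0 < e)%R -> \forall x \near F, (r - e)%:E < f x < (r + e)%:E.
    move=> e0.
    have h1 := limf_einf_gt FF (@lt_le_trans _ _ _ (r - e)%:E _ _ li).
    have h2 := limf_esup_lt FF (@le_lt_trans _ _ _ _ (r + e)%:E ls _).
    have l1 : (r - e)%:E < r%:E by rewrite lte_fin; lra.
    have l2 : r%:E < (r + e)%:E by rewrite lte_fin; lra.
    by apply: filterS2 (h1 l1) (h2 l2) => x -> ->.
  apply/fine_cvgP; split.
    apply: filterS (hi 1%R ltr01) => x /andP[a b].
    by rewrite fin_real// (lt_trans _ a) ?ltNyr// (lt_trans b) ?ltry.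
  apply/cvgrPdist_le => e e0; apply: filterS (hi e e0) => x /=.
  move=> /andP[]; case: (f x) => [s| |]//=.
  by rewrite !lte_fin ler_distlC => a b; apply/andP; split; lra.
- apply/cvgeyPge => A; apply: filterS (limf_einf_gt FF (lt_le_trans (ltry A) li)) => x.
  exact: ltW.
- apply/cvgeNyPle => A; apply: filterS (limf_esup_lt FF (le_lt_trans ls (ltNyr A))) => x.
  exact: ltW.
Qed.

End limits.

(** The infimum of a rate may be infinite, so bounds are tested on real levels [c] below it; for the
    value +oo the level is sent to infinity. *)
Lemma lee_oppmul_of_lt (R : realType) (r : R) (x l : \bar R) : (0 < r)%R ->
  (forall c : R, c%:E < x -> l <= (- (r * c))%:E) -> l <= - (r%:E * x).
Proof.
move=> r0 h; case: x h => [x| |] h.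
- rewrite -EFinM -EFinN; apply/lee_addgt0Pr => e e0.
  have := h (x - e / r)%R; rewrite lte_fin gtrBl divr_gt0// => /(_ isT).
  by congr (_ <= _); rewrite -EFinD; congr EFin; field; rewrite gt_eqF.
- rewrite gt0_muley ?lte_fin//; rewrite leeNy_eq; apply/eqP.
  case: l h => [l| |]// h.
    exfalso; have := h ((1 - l) / r)%R (ltry _).
    by rewrite lee_fin mulrCA mulfV ?gt_eqF// mulr1; lra.
  by have := h 0%R (ltry _).
- by rewrite gt0_muleNy ?lte_fin// leey.
Qed.

Lemma oppmul_le_of_gt (R : realType) (r : R) (x l : \bar R) : (0 < r)%R ->
  (forall c : R, x < c%:E -> (- (r * c))%:E <= l) -> - (r%:E * x) <= l.
Proof.
move=> r0 h; rewrite -leeN2 oppeK -[x]oppeK muleN.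
apply: lee_oppmul_of_lt => // c cx.
have xc : x < (- c)%:E by rewrite EFinN lteNr.
by have := h _ xc; rewrite mulrN opprK EFinN leeN2.
Qed.

(** * Logarithmic rates along the rounded times [N t] *)

Section ldp.
Context (R : realType) (d : nat) (dO : measure_display) (Om : measurableType dO).
Variables (Pr : probability Om R) (S : nat -> Om -> 'rV[nat]_d) (M : 'rV[R]_d -> R).
Hypothesis mS : forall n (A : set 'rV[nat]_d), measurable (S n @^-1` A).
Hypothesis ES : forall theta n,
  \int[Pr]_w (expR (dotr theta (real_vec R (S n w))))%:E = (M theta ^+ n)%:E.
Variable I : 'rV[R]_d -> \bar R.
Hypothesis IE : forall y,
  I y = ereal_sup (range (fun theta => (dotr theta y - ln (M theta))%:E)).
Variables (r : R) (N : R -> nat) (Ev : R -> set Om) (E : R -> set 'rV[nat]_d).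
Hypothesis r0 : (0 < r)%R.
Hypothesis hN : \forall t \near +oo%R, (r * t <= (N t)%:R <= r * t + 1)%R.
Hypothesis hE : \forall t \near +oo%R, Ev t = S (N t) @^-1` E t.

Lemma ldp_lower (G : set 'rV[R]_d) :
  (forall y, G y -> exists2 delta : R, (0 < delta)%R & \forall t \near +oo%R, forall z,
    (forall i, `|real_vec R z 0%R i - (N t)%:R * y 0%R i| < (N t)%:R * delta)%R -> E t z) ->
  - (r%:E * ereal_inf (I @` G)) <= limf_einf (log_rate Pr Ev) +oo%R.
Proof.
move=> hG; apply: oppmul_le_of_gt => // c /ereal_inf_lt[_ [y Gy <-] Iyc].
have yc theta : (dotr theta y - ln (M theta) <= c)%R.
  rewrite -lee_fin ltW//; apply: le_lt_trans Iyc; rewrite IE.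
  by apply: ereal_sup_ubound; exists theta.
(* [theta = 0] gives [c >= 0]; this allows [N t] to be replaced by its upper bound [r * t + 1] in
   the exponent. *)
have c0 : (0 <= c)%R.
  by have := yc 0%R; rewrite dotr0l (exp_moment0 ES) ln1 subr0.
have [delta delta0 hd] := hG y Gy.
apply/lee_addgt0Pr => e e0; rewrite -leeBlDr//; apply: limf_einf_ge.
(* [r * eta] uses half of [e]; the other half absorbs [(c + eta) / t], the cost of rounding [r * t]
   up. *)
pose eta := (e / (2 * r))%R; have eta0 : (0 < eta)%R by rewrite divr_gt0// mulr_gt0.
have [n0 _ hn0] := cramer_lower mS ES delta0 eta0 yc.
near=> t.
have t0 : (0 < t)%R by near: t; exact: nbhs_pinfty_gt.
have /andP[N1 N2] : (r * t <= (N t)%:R <= r * t + 1)%R by near: t.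
have nN : (n0 <= N t)%N.
  rewrite -(ler_nat R); apply: le_trans N1; rewrite -ler_pdivrMl//.
have te : (c + eta <= t * (e / 2))%R.
  have e2 : (0 < e / 2)%R by rewrite divr_gt0.
  rewrite -(ler_pdivrMr _ _ e2).
  by near: t; apply: nbhs_pinfty_ge; rewrite num_real.
have Et z : (forall i, `|real_vec R z 0%R i - (N t)%:R * y 0%R i| < (N t)%:R * delta)%R -> E t z.
  by move: z; near: t.
have Pt : (expR (- ((N t)%:R * (c + eta))))%:E <= Pr (Ev t).
  have -> : Ev t = S (N t) @^-1` E t by near: t.
  apply: le_trans (hn0 _ nN) _; apply: le_measure; rewrite ?inE; [exact: mS..|].
  by move=> w /= /Et.
apply: (@le_trans _ _ ((t^-1)%:E * (- ((N t)%:R * (c + eta)))%:E)); last first.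
  rewrite lee_wpmul2l ?lee_fin ?invr_ge0 ?(ltW t0)//.
  rewrite -[X in X%:E <= _]expRK -lne_EFin ?expR_gt0// lee_lne//.
    by rewrite in_itv/= leey lee_fin expR_ge0.
  by rewrite in_itv/= leey measure_ge0.
rewrite -EFinM -EFinB lee_fin ler_pdivlMl//.
have NN : ((N t)%:R * (c + eta) <= (r * t + 1) * (c + eta))%R.
  by rewrite ler_wpM2r// addr_ge0// ltW.
have reta : (t * (r * eta) = t * (e / 2))%R by rewrite /eta; field; rewrite gt_eqF.
lra.
Unshelve. all: by end_near. Qed.

Lemma ldp_upper (D : set 'rV[R]_d) :
  (forall y, ~ D y -> exists2 delta : R, (0 < delta)%R & \forall t \near +oo%R, forall z,
    (forall i, `|real_vec R z 0%R i - (N t)%:R * y 0%R i| < (N t)%:R * delta)%R -> ~ E t z) ->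
  limf_esup (log_rate Pr Ev) +oo%R <= - (r%:E * ereal_inf (I @` D)).
Proof.
move=> hD; apply: lee_oppmul_of_lt => // c cI.
have [| |K HK] := @cramer_upper _ _ _ _ _ _ _ mS ES R +oo%R _ N E D c _ hD.
- near=> t; rewrite -(ltr_nat R); have /andP[N1 _] : (r * t <= (N t)%:R <= r * t + 1)%R by near: t.
  by apply: lt_le_trans N1; rewrite mulr_gt0//; near: t; exact: nbhs_pinfty_gt.
- move=> y Dy; have : c%:E < I y by apply: lt_le_trans cI _; apply: ereal_inf_lbound; exists y.
  by rewrite IE => /ereal_sup_gt[_ [theta _ <-]]; rewrite lte_fin => ?; exists theta.
apply/lee_addgt0Pr => e e0; apply: limf_esup_le.
(* [K.+1] keeps the logarithm meaningful when [K = 0]; the term in [c] covers the rounding of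
   [r * t], with an absolute value because [c] may have either sign. *)
pose L := (`|c| + ln K.+1%:R)%R.
near=> t.
have t0 : (0 < t)%R by near: t; exact: nbhs_pinfty_gt.
have /andP[N1 N2] : (r * t <= (N t)%:R <= r * t + 1)%R by near: t.
have te : (L <= t * e)%R by rewrite -ler_pdivrMr.
have K0 : (0 < K.+1%:R :> R)%R by rewrite ltr0n.
have Pt : Pr (Ev t) <= (K.+1%:R * expR (- ((N t)%:R * c)))%:E.
  have -> : Ev t = S (N t) @^-1` E t by near: t.
  apply: (@le_trans _ _ (K%:R * expR (- ((N t)%:R * c)))%:E); first by near: t.
  by rewrite lee_fin ler_wpM2r ?expR_ge0// ler_nat.
apply: (@le_trans _ _ ((t^-1)%:E * (ln K.+1%:R - (N t)%:R * c)%:E)).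
  rewrite lee_wpmul2l ?lee_fin ?invr_ge0 ?(ltW t0)//.
  rewrite -[X in (_ + X)%R]expRK -lnM ?posrE ?expR_gt0//.
  rewrite -lne_EFin ?mulr_gt0 ?expR_gt0// lee_lne//.
    by rewrite in_itv/= leey measure_ge0.
  by rewrite in_itv/= leey lee_fin mulr_ge0 ?expR_ge0.
rewrite -EFinM -EFinD lee_fin ler_pdivrMl//.
have : (- ((N t)%:R * c) <= - (r * t * c) + `|c|)%R.
  have -> : (- ((N t)%:R * c) = - (r * t * c) + (r * t - (N t)%:R) * c)%R by ring.
  rewrite lerD2l; apply: le_trans (ler_norm _) _; rewrite normrM.
  rewrite -[leRHS]mul1r ler_wpM2r// ler_norml; apply/andP; split; lra.
move: te; rewrite /L; lra.
Unshelve. all: by end_near. Qed.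

End ldp.

(** * From boxes around [N t * y] to the order relation with [k t] *)

Section directions.
Context (R : realType) (d : nat) (lam : 'rV[R]_d) (k : R -> 'rV[nat]_d).
Variables (r : R) (N : R -> nat).
Hypothesis hk : (norm1 (real_vec R (k t) - t *: lam) / t)%R @[t --> +oo%R] --> (0 : R)%R.
Hypothesis r0 : (0 < r)%R.
Hypothesis hN : \forall t \near +oo%R, (r * t <= (N t)%:R <= r * t + 1)%R.

Lemma direction_close (e : R) : (0 < e)%R -> \forall t \near +oo%R,
  forall i, (`|(k t 0%R i)%:R - t * lam 0%R i| <= e * t)%R.
Proof.
move=> e0; have /cvgrPdist_le /(_ e e0) H := hk.
near=> t => i.
have t0 : (0 < t)%R by near: t; exact: nbhs_pinfty_gt.
have : (`|0 - norm1 (real_vec R (k t) - t *: lam) / t| <= e)%R by near: t.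
rewrite sub0r normrN ger0_norm; last by rewrite divr_ge0 ?(ltW t0)//; exact: sumr_ge0.
rewrite ler_pdivrMr//; apply: le_trans; rewrite /norm1 (bigD1 i)//= !mxE lerDl.
exact: sumr_ge0.
Unshelve. all: by end_near. Qed.

(** Every coordinate leaves a gap of at least [2 * dl]. In units of [r * t], [dl] is spent on the
    radius of the box and [dl / 2] each on the deviation of [k t] from [t * lam] and on the rounding
    of [r * t]. *)
Lemma directions_below (y : 'rV[R]_d) : B_lt (r^-1 *: lam)%R y ->
  exists2 delta : R, (0 < delta)%R & \forall t \near +oo%R, forall z : 'rV[nat]_d,
    (forall i, `|real_vec R z 0%R i - (N t)%:R * y 0%R i| < (N t)%:R * delta)%R ->
    le_vec z (k t).
Proof.
move=> ylt.
have [dl dl0 hdl] : exists2 dl : R, (0 < dl)%R & forall i, (y 0%R i + 2 * dl <= r^-1 * lam 0%R i)%R.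
  exists (\big[Num.min/1]_(i < d) ((r^-1 * lam 0 i - y 0 i) / 2))%R.
    elim/big_ind: _ => // [x z x0 z0|i _]; first by rewrite lt_min x0.
    by rewrite divr_gt0// subr_gt0; have := ylt i; rewrite mxE.
  move=> i; rewrite -lerBrDl -ler_pdivlMl// mulrC; exact: bigmin_le_cond.
exists dl => //.
have e0 : (0 < r * dl / 2)%R by rewrite divr_gt0// mulr_gt0.
near=> t.
have t0 : (0 < t)%R by near: t; exact: nbhs_pinfty_gt.
have /andP[N1 N2] : (r * t <= (N t)%:R <= r * t + 1)%R by near: t.
have hki : forall i, (`|(k t 0%R i)%:R - t * lam 0%R i| <= r * dl / 2 * t)%R.
  by near: t; exact: direction_close.
have ty : (\sum_i `|y 0 i| + dl <= t * (r * dl / 2))%R by rewrite -ler_pdivrMr.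
move=> z hz i; have {hki} := hki i; rewrite ler_distl => /andP[hki _].
have := hz i; rewrite ltr_distl mxE => /andP[_ hzi].
have {}ty : (`|y 0 i| + dl <= t * (r * dl / 2))%R.
  by apply: le_trans ty; rewrite lerD2r (bigD1 i)//= lerDl; exact: sumr_ge0.
rewrite -(ler_nat R).
have h1 : (r * t * (y 0 i + 2 * dl) <= t * lam 0 i)%R.
  have := hdl i; rewrite -(ler_pM2l (mulr_gt0 r0 t0)) => /le_trans; apply.
  by rewrite mulrACA mulfV ?gt_eqF// mul1r.
have h2 : (((N t)%:R - r * t) * (y 0 i + dl) <= `|y 0 i| + dl)%R.
  apply: (@le_trans _ _ (((N t)%:R - r * t) * (`|y 0 i| + dl)))%R.
    by rewrite ler_wpM2l ?subr_ge0// lerD2r ler_norm.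
  by rewrite ler_piMl ?addr_ge0 ?(ltW dl0)//; lra.
lra.
Unshelve. all: by end_near. Qed.

(** One violated coordinate suffices, with the same distribution of its gap [2 * dl] as in
    [directions_below]. *)
Lemma directions_not_below (y : 'rV[R]_d) : ~ B_le (r^-1 *: lam)%R y ->
  exists2 delta : R, (0 < delta)%R & \forall t \near +oo%R, forall z : 'rV[nat]_d,
    (forall i, `|real_vec R z 0%R i - (N t)%:R * y 0%R i| < (N t)%:R * delta)%R ->
    ~ le_vec z (k t).
Proof.
move=> /existsNP[i /negP]; rewrite -ltNge mxE => yi.
pose dl := ((y 0 i - r^-1 * lam 0 i) / 2)%R.
have dl0 : (0 < dl)%R by rewrite divr_gt0// subr_gt0.
have ydl : (y 0 i = r^-1 * lam 0 i + 2 * dl)%R by rewrite /dl; field; rewrite gt_eqF.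
exists dl => //.
have e0 : (0 < r * dl / 2)%R by rewrite divr_gt0// mulr_gt0.
near=> t.
have t0 : (0 < t)%R by near: t; exact: nbhs_pinfty_gt.
have /andP[N1 N2] : (r * t <= (N t)%:R <= r * t + 1)%R by near: t.
have hki : forall i, (`|(k t 0%R i)%:R - t * lam 0%R i| <= r * dl / 2 * t)%R.
  by near: t; exact: direction_close.
have ty : (`|y 0 i| + dl + 1 <= t * (r * dl / 2))%R by rewrite -ler_pdivrMr.
move=> z hz /(_ i); rewrite -(ler_nat R) => zk.
have := hki i; rewrite ler_distl => /andP[_ {}hki].
have := hz i; rewrite ltr_distl mxE => /andP[hzi _].
have h1 : (r * t * y 0 i = t * lam 0 i + 2 * (r * t * dl))%R.
  by rewrite ydl; field; rewrite gt_eqF.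
have h2 : (- (`|y 0 i| + dl) <= ((N t)%:R - r * t) * (y 0 i - dl))%R.
  rewrite lerNl; apply: le_trans (ler_norm _) _; rewrite normrN normrM.
  apply: (@le_trans _ _ (1 * (`|y 0 i| + `|dl|)))%R.
    by apply: ler_pM => //; [rewrite ger0_norm; lra|exact: ler_normB].
  by rewrite mul1r (gtr0_norm dl0).
move: h1 h2 hzi hki ty zk; clear -dl0 t0 r0; lra.
Unshelve. all: by end_near. Qed.

End directions.

(** * Counts expressed by cycle sums, and conclusion *)

Lemma sumr_rVnat_le d (F : nat -> 'rV[nat]_d) m n : (m <= n)%N ->
  le_vec (\sum_(1 <= j < m.+1) F j)%R (\sum_(1 <= j < n.+1) F j)%R.
Proof.
move=> mn i; rewrite (@big_cat_nat _ _ _ m.+1 _ n.+1)//=.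
by rewrite [leqRHS]mxE leq_addr.
Qed.

(** The hypothesis makes [n] the ceiling of [s]. Cycle sums increase, so the admissible indices form
    an initial segment; it contains 0, and if it misses [n] the supremum is at most [n - 1], which
    is strictly below [s]. *)
Lemma cycle_count_ge (R : realType) dX (X : measurableType dX) d dO (Om : measurableType dO)
    (C : set X) (J : nat -> Om -> X) (chi : nat -> Om -> bool) (V : nat -> Om -> 'rV[nat]_d)
    (k : 'rV[nat]_d) (w : Om) (s : R) (n : nat) :
  (forall m : nat, (s <= m%:R)%R = (n <= m)%N) ->
  (s%:E <= cycle_count R C J chi V k w) <-> le_vec (cycle_sum C J chi V n w) k.
Proof.
move=> sn; split; last first.
  move=> nk; apply: (@le_trans _ _ n%:R%:E); first by rewrite lee_fin sn.
  by apply: ereal_sup_ubound; exists n.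
apply: contraPP => nk; apply/negP; rewrite -ltNge.
have n0 : (0 < n)%N.
  rewrite lt0n; apply/negP => /eqP n0; apply: nk => i.
  by rewrite n0 /cycle_sum big_geq// mxE.
apply: (@le_lt_trans _ _ n.-1%:R%:E); last by rewrite lte_fin ltNge sn -ltnNge prednK.
apply: ge_ereal_sup => _ [m mk <-]; rewrite lee_fin ler_nat -ltnS prednK// ltnNge.
apply/negP => nm; apply: nk => i; apply: leq_trans (mk i).
exact: sumr_rVnat_le.
Qed.

Lemma ceil_natP (R : realType) (x : R) : (0 <= x)%R ->
  exists n : nat, (forall m : nat, (x <= m%:R)%R = (n <= m)%N) /\ (x <= n%:R <= x + 1)%R.
Proof.
move=> x0; have c0 : (0 <= Num.ceil x)%R by rewrite ceil_ge0; lra.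
have nE : (`|Num.ceil x|%N%:R = (Num.ceil x)%:~R :> R)%R by rewrite natr_absz ger0_norm.
exists `|Num.ceil x|%N; split.
  move=> m; rewrite -[m%:R]/((m%:Z)%:~R)%R -ceil_le_int -{1}(gez0_abs c0).
  by rewrite lez_nat.
have /andP[a b] := ceil_itv x; rewrite nE b/=; rewrite intrB in a.
by apply: ltW; rewrite -ltrBlDr.
Qed.

Theorem theorem5p3
  (R : realType) (dX : measure_display) (X : measurableType dX)
  (d : nat) (hd : (0 < d)%N)
  (q : 'rV[nat]_d -> R.-ker X ~> X) (pi : probability X R)
  (C : set X) (eps : R) (vtheta : probability (X * 'rV[nat]_d)%type R)
  (hX : standard_borel R X)
  (hq : renewal_kernel q)
  (hP : positive_harris (kerP q) pi)
  (hmu : forall i : 'I_d, 0 < mean_drift q pi i < +oo)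
  (hC : measurable C) (hpiC : 0 < pi C) (heps : (0 < eps <= 1)%R)
  (hmin : minorization q C eps vtheta)
  (dO : measure_display) (Om : measurableType dO) (Pa : probability Om R)
  (J : nat -> Om -> X) (chi : nat -> Om -> bool) (V : nat -> Om -> 'rV[nat]_d)
  (hchain : split_chain_from_atom q pi C eps vtheta Pa J chi V)
  (hLambda : forall theta : 'rV[R]_d, Lambda_Y C J chi V Pa theta < +oo)
  (lam : 'rV[R]_d) (hlam : simplex_dir lam)
  (k : R -> 'rV[nat]_d)
  (hk : (norm1 (real_vec R (k t) - t *: lam) / t)%R @[t --> +oo%R] --> (0 : R)%R)
  (r : R) (hr : (0 < r)%R) :
  let I := I_Y C J chi V Pa in
  let ge_rate := log_rate Pa
    (fun t => [set w | (r * t)%:E <= cycle_count R C J chi V (k t) w]) in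
  let lt_rate := log_rate Pa
    (fun t => [set w | cycle_count R C J chi V (k t) w < (r * t)%:E]) in
  let a := (r^-1 *: lam)%R in
  ((kappa C J chi V Pa lam < r)%R ->
    [/\ - (r%:E * ereal_inf (I @` B_lt a)) <= limf_einf ge_rate +oo%R,
        limf_esup ge_rate +oo%R <= - (r%:E * ereal_inf (I @` B_le a)) &
        ereal_inf (I @` B_lt a) = ereal_inf (I @` B_le a) ->
          cvg (ge_rate t @[t --> +oo%R])]) /\
  ((r < kappa C J chi V Pa lam)%R ->
    [/\ - (r%:E * ereal_inf (I @` (~` B_le a))) <= limf_einf lt_rate +oo%R,
        limf_esup lt_rate +oo%R <= - (r%:E * ereal_inf (I @` (~` B_lt a))) &
        ereal_inf (I @` (~` B_le a)) = ereal_inf (I @` (~` B_lt a)) ->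
          cvg (lt_rate t @[t --> +oo%R])]).
Proof.
move=> I ge_rate lt_rate a.
have [_ hinv] := hP.
pose S := cycle_sum C J chi V.
pose M theta := fine 'E_Pa[fun w => expR (dotr theta (real_vec R (Defs.cycle C J chi V 1%N w)))].
have LE theta : 'E_Pa[fun w => expR (dotr theta (real_vec R (Defs.cycle C J chi V 1%N w)))] =
    (M theta)%:E.
  rewrite /M fineK// ge0_fin_numE; last first.
    by apply: expectation_ge0 => w; exact: expR_ge0.
  have := hLambda theta; rewrite /Lambda_Y; case: ('E_Pa[_]) => [x| |]//= _.
  by rewrite ltry.
have mS := measurable_cycle_sum hchain.
have ES theta n : \int[Pa]_w (expR (dotr theta (real_vec R (S n w))))%:E = (M theta ^+ n)%:E.
  apply: (cycle_sum_moment hC heps hmin hchain hpiC hinv).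
  by rewrite -LE unlock.
have M0 := exp_moment_gt0 mS ES.
have IE y : I y = ereal_sup (range (fun theta => (dotr theta y - ln (M theta))%:E)).
  rewrite /I /I_Y (_ : (fun theta => (dotr theta y)%:E - Lambda_Y C J chi V Pa theta) =
    (fun theta => (dotr theta y - ln (M theta))%:E))//.
  by apply/funext => theta; rewrite /Lambda_Y LE lne_EFin.
(* [N t] is the ceiling of [r * t]; negative [t] get the default value 0. *)
have /choice[N hN] : forall t : R, exists n : nat, (0 <= t)%R ->
    (forall m : nat, (r * t <= m%:R)%R = (n <= m)%N) /\ (r * t <= n%:R <= r * t + 1)%R.
  move=> t; have [t0|t0] := leP 0%R t; last by exists 0%N.
  by have [n hn] := ceil_natP (mulr_ge0 (ltW hr) t0); exists n.
have hN1 : \forall t \near +oo%R, (r * t <= (N t)%:R <= r * t + 1)%R.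
  by near=> t; have [] // := hN t _; near: t; exact: nbhs_pinfty_ge.
have geE : \forall t \near +oo%R,
    [set w | (r * t)%:E <= cycle_count R C J chi V (k t) w] =
    S (N t) @^-1` [set z | le_vec z (k t)].
  near=> t; have [hNt _] : (forall m : nat, (r * t <= m%:R)%R = (N t <= m)%N) /\
      (r * t <= (N t)%:R <= r * t + 1)%R by apply: hN; near: t; exact: nbhs_pinfty_ge.
  by apply/seteqP; split=> w /= /(cycle_count_ge _ _ _ _ _ _ hNt).
have ltE : \forall t \near +oo%R,
    [set w | cycle_count R C J chi V (k t) w < (r * t)%:E] =
    S (N t) @^-1` [set z | ~ le_vec z (k t)].
  near=> t.
  transitivity (~` [set w | (r * t)%:E <= cycle_count R C J chi V (k t) w]).
    by apply/seteqP; split=> w /=; [rewrite ltNge => /negP|move/negP; rewrite -ltNge].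
  rewrite (_ : [set w | _] = S (N t) @^-1` [set z | le_vec z (k t)])//.
  by near: t.
(* Strictly inside the orthant a neighbourhood forces the cycle sum below [k t], strictly outside it
   forces the negation. For counts at least [r * t] these give the lower and the upper bound
   respectively; for counts below [r * t] they exchange roles. *)
have alpha := directions_below hk hr hN1.
have beta := directions_not_below hk hr hN1.
have geL : - (r%:E * ereal_inf (I @` B_lt a)) <= limf_einf ge_rate +oo%R.
  exact: (ldp_lower mS ES IE hr hN1 geE alpha).
have geU : limf_esup ge_rate +oo%R <= - (r%:E * ereal_inf (I @` B_le a)).
  exact: (ldp_upper mS ES IE hr hN1 geE beta).
have ltL : - (r%:E * ereal_inf (I @` (~` B_le a))) <= limf_einf lt_rate +oo%R.
  exact: (ldp_lower mS ES IE hr hN1 ltE beta).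
have ltU : limf_esup lt_rate +oo%R <= - (r%:E * ereal_inf (I @` (~` B_lt a))).
  apply: (ldp_upper mS ES IE hr hN1 ltE) => y /contrapT /alpha[delta delta0 h].
  by exists delta => //; apply: filterS h => t h z /h zk; exact.
split=> _; split=> // infE.
- apply/cvg_ex; exists (- (r%:E * ereal_inf (I @` B_le a))); apply: cvg_limf geU.
  by rewrite -infE.
- apply/cvg_ex; exists (- (r%:E * ereal_inf (I @` (~` B_lt a)))); apply: cvg_limf ltU.
  by rewrite -infE.
Unshelve. all: by end_near. Qed.
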